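(* Let $n\geq 3$. For every $\epsilon>0$ there exists a measurable set $E\subset\mathbb{R}^n$ with $[0,1]^n\subset E\subset[-\epsilon,1+\epsilon]^n$ such that $E$ tiles $\mathbb{R}^n$ by translations, but $E$ admits no tiling by translations whose translation set is a lattice.
   Context: A measurable set $E\subset\mathbb{R}^n$ with $0<|E|<\infty$ tiles $\mathbb{R}^n$ by translations if there is a discrete set $T\subset\mathbb{R}^n$ such that, up to sets of measure zero, the sets $E+t$, $t\in T$, are pairwise disjoint and their union is $\mathbb{R}^n$; $T$ is the translation set. A lattice in $\mathbb{R}^n$ is a set of the form $A\mathbb{Z}^n$ with $A$ an invertible linear map of $\mathbb{R}^n$. *)

(* Defs.v *)
From HB Require Import structures.
From mathcomp Require Import all_boot all_order all_algebra.
From mathcomp Require Import all_classical all_reals all_analysis.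

Set Implicit Arguments.
Unset Strict Implicit.
Unset Printing Implicit Defensive.

Import Order.TTheory GRing.Theory Num.Theory.
Local Open Scope classical_set_scope.
Local Open Scope ring_scope.

Definition box (R : realType) (n : nat) (a b : 'rV[R]_n) : set 'rV[R]_n :=
  [set x | forall i, a 0 i <= x 0 i < b 0 i].

Definition box_vol (R : realType) (n : nat) (a b : 'rV[R]_n) : R :=
  \prod_(i < n) Num.max 0 (b 0 i - a 0 i).

Definition lebesgue_outer (R : realType) (n : nat) (A : set 'rV[R]_n) : \bar R :=
  ereal_inf [set s : \bar R | exists a b : nat -> 'rV[R]_n,
              A `<=` \bigcup_k box (a k) (b k) /\
              s = (\sum_(0 <= k <oo) (box_vol (a k) (b k))%:E)%E].

Definition lebesgue_measurable (R : realType) (n : nat) (E : set 'rV[R]_n) : Prop :=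
  (@lebesgue_outer R n).-caratheodory E.

Definition translate (R : realType) (n : nat) (E : set 'rV[R]_n) (t : 'rV[R]_n)
  : set 'rV[R]_n := [set x + t | x in E].

Definition discrete_set (R : realType) (n : nat) (T : set 'rV[R]_n) : Prop :=
  forall r : R, finite_set [set t | T t /\ forall i, `|t 0 i| <= r].

Definition tiling_of (R : realType) (n : nat) (E T : set 'rV[R]_n) : Prop :=
  [/\ lebesgue_measurable E /\
        (0 < lebesgue_outer E)%E /\ (lebesgue_outer E < +oo)%E,
      discrete_set T,
      (forall t t', T t -> T t' -> t != t' ->
         lebesgue_outer (translate E t `&` translate E t') = 0%E) &
      lebesgue_outer (~` \bigcup_(t in T) translate E t) = 0%E].

Definition tiles (R : realType) (n : nat) (E : set 'rV[R]_n) : Prop :=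
  exists T, tiling_of E T.

Definition lattice (R : realType) (n : nat) (A : 'M[R]_n) : set 'rV[R]_n :=
  [set x | exists k : 'rV[int]_n, x = map_mx (fun z : int => z%:~R) k *m A].

Definition tiles_by_lattice (R : realType) (n : nat) (E : set 'rV[R]_n) : Prop :=
  exists A : 'M[R]_n, A \in unitmx /\ tiling_of E (lattice A).

(* Main.v *)
Require Import Defs.
From HB Require Import structures.
From mathcomp Require Import all_boot all_order all_algebra.
From mathcomp Require Import all_classical all_reals all_analysis.
From mathcomp Require Import measurable_realfun ring lra zify.
Set Implicit Arguments.
Unset Strict Implicit.
Unset Printing Implicit Defensive.
Import Order.TTheory GRing.Theory Num.Theory.
Local Open Scope classical_set_scope.
Local Open Scope ring_scope.

(** Let [w] be small and [P = 1 + 3 w]. From the cube [[0, P)^n] we cut out four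
    small pits [K_1], ..., [K_4] near its boundary, and we glue the pins
    [K_j - v_j], where, in the first three coordinates,
      [K_2 = K_1 + (0, 0, P/2)], [v_1 = v_2 = (P, 0, 0)], [v_3 = (P, P, 0)],
      [v_4 = (- P, P, P/2)],
    and all the other coordinates of the [v_j] vanish.
    The cubes can be stacked in columns parallel to the third axis, and the columns
    shifted by half a period independently of each other. The shift
    [s(i, j)], in [{0, 1/2}], of the column [(i, j)] has to satisfy
    [s(i + 1, j + 1) = s(i, j)] (pit 3) and [s(i - 1, j + 1) <> s(i, j)] (pit 4),
    whereas the pits 1 and 2 only force the shifts to be multiples of [1/2].
    This is solved by taking for [s] a function of [(i - j)] mod 4.
    In a tiling by a lattice, the pits have such shapes that each of them is filled
    exactly by its own pin (or, for the pits 1 and 2, by the pin of the other), so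
    that the lattice contains [(P, 0, a)] with [a = 0] or [a = - P/2], [(P, P, 0)]
    and [(- P, P, P/2)]. But [2 (P, 0, a) - (P, P, 0) + (- P, P, P/2)] is
    [(0, 0, P/2)] or [(0, 0, - P/2)], which is too short. *)

(** * Lebesgue outer measure *)

Lemma box_vol_ge0 (R : realType) (n : nat) (a b : 'rV[R]_n) : 0 <= box_vol a b.
Proof. by apply: prodr_ge0 => i _; rewrite le_max lexx. Qed.

Lemma lebesgue_outer_le (R : realType) (n : nat) (A : set 'rV[R]_n)
    (a b : nat -> 'rV[R]_n) :
  A `<=` \bigcup_k box (a k) (b k) ->
  (lebesgue_outer A <= \sum_(0 <= k <oo) (box_vol (a k) (b k))%:E)%E.
Proof. by move=> Aab; apply: ereal_inf_lbound; exists a, b. Qed.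

Lemma lebesgue_outer_ge0 (R : realType) (n : nat) (A : set 'rV[R]_n) :
  (0 <= lebesgue_outer A)%E.
Proof.
apply: le_ereal_inf_tmp => _ [a [b [_ ->]]].
by apply: nneseries_ge0 => k _ _; rewrite lee_fin box_vol_ge0.
Qed.

Lemma le_lebesgue_outer (R : realType) (n : nat) :
  {homo @lebesgue_outer R n : A B / A `<=` B >-> (A <= B)%E}.
Proof.
move=> A B AB; apply: ereal_inf_le_tmp => _ [a [b [Bab ->]]].
by exists a, b; split => //; exact: subset_trans Bab.
Qed.

Lemma lebesgue_outer_sub_box (R : realType) (n : nat) (A : set 'rV[R]_n.+1)
    (a b : 'rV[R]_n.+1) :
  A `<=` box a b -> (lebesgue_outer A <= (box_vol a b)%:E)%E.
Proof.
(* All boxes but the first are the empty [box a a]. Its volume, a product over the coordinates,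
   vanishes only because the dimension [n.+1] is positive. *)
move=> Aab; pose b' k := if k is 0%N then b else a.
have Aab' : A `<=` \bigcup_k box a (b' k).
  by move=> x /Aab abx; exists 0%N.
apply: (le_trans (lebesgue_outer_le Aab')).
rewrite nneseries_recl//; last by move=> k _; rewrite lee_fin box_vol_ge0.
rewrite eseries0 ?adde0// => -[//|k] _ _.
by rewrite /box_vol (bigD1 ord0)//= subrr maxxx mul0r.
Qed.

Lemma lebesgue_outer0 (R : realType) (n : nat) :
  @lebesgue_outer R n.+1 set0 = 0%E.
Proof.
apply/eqP; rewrite eq_le lebesgue_outer_ge0 andbT.
apply: (le_trans (@lebesgue_outer_sub_box _ _ _ 0 0 (@sub0set _ _))).
by rewrite /box_vol (bigD1 ord0)//= subrr maxxx mul0r.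
Qed.

Lemma lebesgue_outer_approx (R : realType) (n : nat) (A : set 'rV[R]_n) (e : R) :
  0 < e -> lebesgue_outer A \is a fin_num ->
  exists ab : nat -> 'rV[R]_n * 'rV[R]_n,
    A `<=` \bigcup_k box (ab k).1 (ab k).2 /\
    (\sum_(0 <= k <oo) (box_vol (ab k).1 (ab k).2)%:E <= lebesgue_outer A + e%:E)%E.
Proof.
move=> e0 Afin.
have [_ [a [b [Aab ->]]] /ltW] := lb_ereal_inf_adherent e0 Afin.
by exists (fun k => (a k, b k)).
Qed.

(** Covers of the [A k], optimal up to e / 2^(k+1), are merged into one sequence of boxes along a
    bijection between [nat] and [nat * nat]. *)
Lemma lebesgue_outer_sigma_subadditive (R : realType) (n : nat) :
  sigma_subadditive (@lebesgue_outer R n).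
Proof.
move=> A; have [[i ioo]|] := pselect (exists i, lebesgue_outer (A i) = +oo%E).
  by rewrite (eseries_pinfty _ _ ioo) ?leey// => k _;
    rewrite -ltNye (lt_le_trans _ (lebesgue_outer_ge0 _)).
rewrite -forallNE => Aoo.
apply/lee_addgt0Pr => _/posnumP[e].
rewrite (le_trans _ (epsilon_trick _ _ _))//; last first.
  by move=> k; exact: lebesgue_outer_ge0.
have Afin k : lebesgue_outer (A k) \is a fin_num.
  by rewrite ge0_fin_numE ?lebesgue_outer_ge0// ltey; apply/eqP.
have /choice[G PG] : forall k, exists ab : nat -> 'rV[R]_n * 'rV[R]_n,
    A k `<=` \bigcup_j box (ab j).1 (ab j).2 /\
    (\sum_(0 <= j <oo) (box_vol (ab j).1 (ab j).2)%:E <=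
      lebesgue_outer (A k) + (e%:num / (2 ^ k.+1)%:R)%:E)%E.
  by move=> k; exact: lebesgue_outer_approx.
have /card_esym/ppcard_eqP[f] := card_nat2.
pose H k := uncurry G (f k).
pose vol (ab : 'rV[R]_n * 'rV[R]_n) : \bar R := (box_vol ab.1 ab.2)%:E.
have vol0 ab : (0 <= vol ab)%E by rewrite lee_fin box_vol_ge0.
apply: (@le_trans _ _ (\esum_(i in setT) (vol (uncurry G i)))%E).
  have AH : \bigcup_k A k `<=` \bigcup_k box (H k).1 (H k).2.
    move=> x [i _] /(PG i).1 [j _ xij].
    by exists (f^-1%FUN (i, j)) => //; rewrite /H invK ?inE.
  apply: (le_trans (lebesgue_outer_le AH)).
  rewrite (@nneseries_esumT R (fun k => (vol (uncurry G (f k)))))//.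
  rewrite -(@reindex_esum R _ _ setT setT f (fun i => vol (uncurry G i)))//.
rewrite (_ : esum _ _ = \sum_(i <oo) \sum_(j <oo ) vol (G i j))%E; last first.
  pose J : nat -> set (nat * nat) := fun i => [set (i, j) | j in setT].
  rewrite (_ : setT = \bigcup_k J k); last first.
    by rewrite predeqE => -[a b]; split => // _; exists a => //; exists b.
  rewrite esum_bigcupT /=; last 2 first.
    - apply/trivIsetP => i j _ _ ij.
      rewrite predeqE => -[p m] /=; split => //= -[] [_] _ [<-{p} _].
      by move=> [m' _] [] /esym/eqP; rewrite (negbTE ij).
    - by move=> /= [p m].
  rewrite nneseries_esumT; last by move=> i; exact: nneseries_ge0.
  apply: eq_esum => i _.
  rewrite nneseries_esumT//.
  rewrite (@reindex_esum R _ _ setT (J i) (pair i) (fun ij => vol (uncurry G ij)))//.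
  split; [by move=> j _; exists j | by move=> ? ? _ _ [] | by move=> _ [j _ <-]; exists j].
apply: lee_nneseries => [k _ _|k _]; [exact: nneseries_ge0 | exact: (PG k).2].
Qed.

HB.instance Definition _ (R : realType) (n : nat) :=
  isOuterMeasure.Build R 'rV[R]_n.+1 (@lebesgue_outer R n.+1)
    (@lebesgue_outer0 R n) (@lebesgue_outer_ge0 R n.+1)
    (@le_lebesgue_outer R n.+1) (@lebesgue_outer_sigma_subadditive R n.+1).

(** * Measurability of half-spaces and boxes *)

Definition rv_upd (R : realType) (n : nat) (a : 'rV[R]_n) (i : 'I_n) (c : R) :
  'rV[R]_n := \row_j (if j == i then c else a 0 j).

Lemma rv_updE (R : realType) (n : nat) (a : 'rV[R]_n) (i : 'I_n) (c : R) j :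
  rv_upd a i c 0 j = if j == i then c else a 0 j.
Proof. by rewrite mxE. Qed.

(** The truncation at 0 in [box_vol] makes this valid also for empty boxes and for cuts that miss
    the box. *)
Lemma box_vol_split (R : realType) (n : nat) (a b : 'rV[R]_n) (i : 'I_n) (c : R) :
  box_vol a (rv_upd b i (Num.min (b 0 i) c)) +
    box_vol (rv_upd a i (Num.max (a 0 i) c)) b = box_vol a b.
Proof.
rewrite /box_vol 3!(bigD1 i isT)/= !rv_updE eqxx.
under [X in _ * X + _]eq_bigr => j /negbTE ji do rewrite rv_updE ji.
under [X in _ + _ * X]eq_bigr => j /negbTE ji do rewrite rv_updE ji.
rewrite -mulrDl; congr (_ * _).
rewrite /Num.max /Num.min.
by case: (ltP (b 0 i) c) => ?; case: (ltP (a 0 i) c) => ?; do ![case: ltP => ?]; lra.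
Qed.

(** Cutting every box of a cover of [X] along the hyperplane yields covers of the two parts of [X],
    with the same total volume. *)
Lemma halfspace_measurable (R : realType) (n : nat) (i : 'I_n.+1) (c : R) :
  lebesgue_measurable [set x : 'rV[R]_n.+1 | x 0 i < c].
Proof.
rewrite /lebesgue_measurable; set H := [set x | _].
apply: le_caratheodory_measurable => X /=.
apply: le_ereal_inf_tmp => _ [a [b [Xab ->]]].
pose b' k := rv_upd (b k) i (Num.min (b k 0 i) c).
pose a' k := rv_upd (a k) i (Num.max (a k 0 i) c).
have XH : X `&` H `<=` \bigcup_k box (a k) (b' k).
  move=> x [/Xab[k _ xk] xc]; exists k => // j; rewrite rv_updE.
  by case: eqP => [->|_]; rewrite ?lt_min ?(xk _)// andbA (xk i).
have XHC : X `&` ~` H `<=` \bigcup_k box (a' k) (b k).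
  move=> x [/Xab[k _ xk] /negP xc]; exists k => // j; rewrite rv_updE.
  case: eqP => [->|_]; rewrite ?(xk _)// ge_max.
  by rewrite [c <= _]leNgt xc andbT; have /andP[-> ->] := xk i.
apply: (le_trans (leeD (lebesgue_outer_le XH) (lebesgue_outer_le XHC))).
rewrite -nneseriesD//; last 2 first.
- by move=> k _; rewrite lee_fin box_vol_ge0.
- by move=> k _; rewrite lee_fin box_vol_ge0.
apply: lee_nneseries => [k _ _|k _].
  by rewrite adde_ge0 ?lee_fin ?box_vol_ge0.
by rewrite -EFinD box_vol_split.
Qed.

Lemma box_halfspaces (R : realType) (n : nat) (a b : 'rV[R]_n) :
  box a b = \big[setI/setT]_(i <- enum 'I_n)
    (~` [set x : 'rV[R]_n | x 0 i < a 0 i] `&` [set x | x 0 i < b 0 i]).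
Proof.
rewrite -bigcap_seq; apply/seteqP; split => [x abx i _ /=|x abx i].
  by split; [apply/negP; rewrite -leNgt|]; have /andP[] := abx i.
have [|/negP] := abx i; first by rewrite /= mem_enum.
by rewrite -leNgt => ->.
Qed.

Lemma box_measurable (R : realType) (n : nat) (a b : 'rV[R]_n.+1) :
  lebesgue_measurable (box a b).
Proof.
rewrite box_halfspaces.
elim/big_ind : _ => [|A B|i _].
- rewrite -setC0; apply: caratheodory_measurable_setC.
  exact: caratheodory_measurable_set0.
- exact: caratheodory_measurable_setI.
- apply: caratheodory_measurable_setI; last exact: halfspace_measurable.
  by apply: caratheodory_measurable_setC; exact: halfspace_measurable.
Qed.

(* Integrate the hypothesis over [A, B[. *)
Lemma cover_interval_weighted (R : realType) (c a b : nat -> R) (C A B : R) :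
  A <= B -> (forall k, 0 <= c k) ->
  (forall u, A <= u < B ->
     (C%:E <= \sum_(0 <= k <oo) (c k * (a k <= u < b k)%R%:R)%:E)%E) ->
  ((C * (B - A))%:E <= \sum_(0 <= k <oo) (c k * Num.max 0 (b k - a k))%:E)%E.
Proof.
move=> AB c0 hC.
have [C0|/ltW C0] := leP C 0.
  apply: (@le_trans _ _ 0%E).
    by rewrite lee_fin mulr_le0_ge0// subr_ge0.
  by apply: nneseries_ge0 => k _ _; rewrite lee_fin mulr_ge0// le_max lexx.
pose f k (u : R) : \bar R := (c k * (a k <= u < b k)%R%:R)%:E.
have fE k : f k = (fun u => (c k)%:E * (\1_(`[a k, b k[%classic) u)%:E)%E.
  by apply/funext => u; rewrite /f indicE mem_setE/= in_itv/= EFinM.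
have mf k : measurable_fun `[A, B[%classic (f k).
  rewrite fE; apply: measurable_funTS.
  apply: emeasurable_funM => //.
  apply/measurable_EFinP; exact: measurable_indic.
have f0 k u : (0 <= f k u)%E by rewrite lee_fin mulr_ge0.
have mI : measurable (`[A, B[%classic : set R) by exact: measurable_itv.
have : (\int[lebesgue_measure]_(x in `[A, B[%classic) (cst C%:E) x <=
        \int[lebesgue_measure]_(x in `[A, B[%classic) \sum_(0 <= k <oo) f k x)%E.
  apply: ge0_le_integral => //.
  exact: (@ge0_emeasurable_sum _ _ _ _ f xpredT (fun k u _ _ => f0 k u) (fun k _ => mf k)).
rewrite integral_cst//= lebesgue_measure_itv/= lte_fin.
have -> : (C%:E * (if (A < B)%R then B%:E - A%:E else 0) = (C * (B - A))%:E)%E.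
  have [_|BA] := ltP A B; first by rewrite EFinM EFinB.
  by rewrite (@le_anti _ _ A B) ?AB// subrr mulr0 mule0.
move=> /le_trans; apply.
rewrite integral_nneseries//.
apply: lee_nneseries => [k _ _|k _]; first exact: integral_ge0.
rewrite fE ge0_integralZl//; last 2 first.
- apply/measurable_EFinP; exact: measurable_indic.
- by rewrite lee_fin.
rewrite EFinM lee_wpmul2l// ?lee_fin// integral_indic//.
apply: (@le_trans _ _ (lebesgue_measure `[a k, b k[%classic)).
  by apply: le_measure; rewrite ?inE//; exact: measurableI.
rewrite lebesgue_measure_itv/= lte_fin.
by case: ltP => ab; rewrite -?EFinB lee_fin le_max ?lexx ?orbT.
Qed.

(** At each point of the large box, the number of covering boxes is at least 1. This inequality is
    integrated over one coordinate after the other, so the one-dimensional integral suffices. *)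
Lemma box_vol_le_cover (R : realType) (n : nat) (A B : 'rV[R]_n)
    (a b : nat -> 'rV[R]_n) :
  (forall i, A 0 i < B 0 i) ->
  box A B `<=` \bigcup_k box (a k) (b k) ->
  ((box_vol A B)%:E <= \sum_(0 <= k <oo) (box_vol (a k) (b k))%:E)%E.
Proof.
move=> AB cov.
(* The first [m] coordinates have been integrated out, the others are frozen at [x]. *)
pose g m k (x : 'rV[R]_n) : R := \prod_(i < n)
  (if (i < m)%N then Num.max 0 (b k 0 i - a k 0 i)
   else (a k 0 i <= x 0 i < b k 0 i)%R%:R).
pose C m : R := \prod_(i < n) (if (i < m)%N then B 0 i - A 0 i else 1).
have main m : (m <= n)%N -> forall x, box A B x ->
    ((C m)%:E <= \sum_(0 <= k <oo) (g m k x)%:E)%E.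
  have term_ge0 k p (x : 'rV[R]_n) (i : 'I_n) : 0 <=
      (if (i < p)%N then Num.max 0 (b k 0 i - a k 0 i)
       else (a k 0 i <= x 0 i < b k 0 i)%R%:R).
    by case: ifP => // _; rewrite le_max lexx.
  have g_ge0 p k x : 0 <= g p k x by apply: prodr_ge0 => i _.
  elim: m => [_ x ABx|m IH mn x ABx].
    have [k _ abx] := cov _ ABx.
    rewrite (@nneseriesD1 R (fun k => (g 0%N k x)%:E) k xpredT)//; last first.
      by move=> j _; rewrite lee_fin.
    rewrite (_ : g 0%N k x = 1); last by apply: big1 => i _; rewrite abx.
    rewrite (_ : C 0%N = 1); last exact: big1.
    by rewrite leeDl//; apply: nneseries_ge0 => j _ _; rewrite lee_fin.
  pose i0 := Ordinal mn.
  pose c k : R := \prod_(i < n | i != i0)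
    (if (i < m)%N then Num.max 0 (b k 0 i - a k 0 i)
     else (a k 0 i <= x 0 i < b k 0 i)%R%:R).
  have ltS (i : 'I_n) : i != i0 -> (i < m.+1)%N = (i < m)%N.
    by rewrite ltnS leq_eqVlt -val_eqE /= => /negbTE ->.
  have -> : C m.+1 = C m * (B 0 i0 - A 0 i0).
    rewrite /C 2!(bigD1 i0 isT)/= ltnn ltnSn mul1r mulrC; congr (_ * _).
    by apply: eq_bigr => i /ltS ->.
  have gS k : g m.+1 k x = c k * Num.max 0 (b k 0 i0 - a k 0 i0).
    rewrite /g (bigD1 i0 isT)/= ltnSn mulrC; congr (_ * _).
    by apply: eq_bigr => i /ltS ->.
  under eq_eseriesr => k _ do rewrite gS.
  apply: cover_interval_weighted => [|k|u ABu]; first exact/ltW/AB.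
    exact: prodr_ge0.
  (* The induction hypothesis will be used at [x] with its coordinate [i0] replaced by the
     integration variable [u]. *)
  have gm k : c k * (a k 0 i0 <= u < b k 0 i0)%R%:R = g m k (rv_upd x i0 u).
    rewrite /g (bigD1 i0 isT)/= ltnn rv_updE eqxx mulrC; congr (_ * _).
    by apply: eq_bigr => i /negbTE ii0; rewrite rv_updE ii0.
  under eq_eseriesr => k _ do rewrite gm.
  apply: IH => [|i]; first exact: ltnW.
  by rewrite rv_updE; case: eqP => [->|_]//; exact: ABx.
have ABA : box A B A by move=> i; rewrite lexx AB.
have := main n (leqnn n) A ABA.
rewrite (_ : C n = box_vol A B); last first.
  apply: eq_bigr => i _; rewrite ltn_ord max_r// subr_ge0; exact/ltW/AB.
have gn k : g n k A = box_vol (a k) (b k).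
  by apply: eq_bigr => i _; rewrite ltn_ord.
by under eq_eseriesr => k _ do rewrite gn.
Qed.

Lemma lebesgue_outer_box_gt0 (R : realType) (n : nat) (A : set 'rV[R]_n)
    (a b : 'rV[R]_n) :
  (forall i, a 0 i < b 0 i) -> box a b `<=` A -> (0 < lebesgue_outer A)%E.
Proof.
move=> ab abA; apply: (@lt_le_trans _ _ (box_vol a b)%:E).
  by rewrite lte_fin prodr_gt0// => i _; rewrite lt_max subr_gt0 ab orbT.
apply: le_ereal_inf_tmp => _ [c [d [Acd ->]]].
by apply: box_vol_le_cover => //; exact: subset_trans Acd.
Qed.

(** * Tilings by finite unions of half-open boxes *)

(* Clopen for the topology generated by the half-open boxes: a nonempty set of this
   kind is not null, so a tiling by such a set is a partition. *)
Definition right_clopen (R : realType) (n : nat) (A : set 'rV[R]_n) : Prop :=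
  forall x : 'rV[R]_n, exists2 r : R, 0 < r &
    forall y : 'rV[R]_n, (forall i, x 0 i <= y 0 i < x 0 i + r) -> (A y <-> A x).

Lemma right_clopenC (R : realType) (n : nat) (A : set 'rV[R]_n) :
  right_clopen A -> right_clopen (~` A).
Proof.
by move=> cA x; have [r r0 rA] := cA x; exists r => // y /rA Axy /=; rewrite Axy.
Qed.

Lemma right_clopenI (R : realType) (n : nat) (A B : set 'rV[R]_n) :
  right_clopen A -> right_clopen B -> right_clopen (A `&` B).
Proof.
move=> cA cB x; have [r r0 rA] := cA x; have [s s0 sB] := cB x.
exists (Num.min r s) => [|y xy]; first by rewrite lt_min r0.
have xyr i : x 0 i <= y 0 i < x 0 i + r.
  have /andP[-> /lt_le_trans-> //] := xy i.
  by rewrite lerD2l ge_min lexx.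
have xys i : x 0 i <= y 0 i < x 0 i + s.
  have /andP[-> /lt_le_trans-> //] := xy i.
  by rewrite lerD2l ge_min lexx orbT.
by rewrite /setI/= (rA _ xyr) (sB _ xys).
Qed.

Lemma right_clopen_halfspace (R : realType) (n : nat) (i : 'I_n) (c : R) :
  right_clopen [set x : 'rV[R]_n | x 0 i < c].
Proof.
move=> x; have [xc|cx] := ltP (x 0 i) c.
  exists (c - x 0 i) => [|y /(_ i)]; first by rewrite subr_gt0.
  by rewrite addrC subrK => /andP[_ yc]; split.
exists 1 => // y /(_ i)/andP[xy _]; split => /=; last by rewrite ltNge cx.
by rewrite ltNge (le_trans cx xy).
Qed.

Lemma right_clopen_box (R : realType) (n : nat) (a b : 'rV[R]_n) :
  right_clopen (box a b).
Proof.
rewrite box_halfspaces.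
elim/big_ind : _ => [|A B|i _].
- by move=> x; exists 1.
- exact: right_clopenI.
- apply: right_clopenI; last exact: right_clopen_halfspace.
  by apply: right_clopenC; exact: right_clopen_halfspace.
Qed.

Lemma translateE (R : realType) (n : nat) (A : set 'rV[R]_n) (t x : 'rV[R]_n) :
  translate A t x <-> A (x - t).
Proof.
split=> [[y Ay <-]|Axt]; first by rewrite addrK.
by exists (x - t) => //; rewrite subrK.
Qed.

Lemma right_clopen_translate (R : realType) (n : nat) (A : set 'rV[R]_n) t :
  right_clopen A -> right_clopen (translate A t).
Proof.
move=> cA x; have [r r0 rA] := cA (x - t); exists r => // y xy.
rewrite !translateE; apply: rA => i.
by have := xy i; rewrite !mxE; lra.
Qed.

Lemma right_clopen_outer_gt0 (R : realType) (n : nat) (A : set 'rV[R]_n) x :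
  right_clopen A -> A x -> (0 < lebesgue_outer A)%E.
Proof.
move=> cA Ax; have [r r0 rA] := cA x.
apply: (@lebesgue_outer_box_gt0 _ _ _ x (x + const_mx r)) => [i|y xy].
  by rewrite !mxE ltrDl.
by rewrite rA// => i; have := xy i; rewrite !mxE.
Qed.

Lemma right_clopen_tiling_disjoint (R : realType) (n : nat) (E T : set 'rV[R]_n)
    (x t t' : 'rV[R]_n) :
  right_clopen E -> tiling_of E T -> T t -> T t' -> E (x - t) -> E (x - t') ->
  t = t'.
Proof.
move=> cE [_ _ dis _] Tt Tt' Ext Ext'; apply/eqP/negP => /negP tt'.
have := dis _ _ Tt Tt' tt' => /eqP; rewrite gt_eqF//.
apply: (@right_clopen_outer_gt0 _ _ _ x).
  by apply: right_clopenI; exact: right_clopen_translate.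
by split; rewrite translateE.
Qed.

(** Only finitely many translates come near [x], as [E] is bounded and [T] discrete. If all of them
    miss [x], they miss a small box with lowest corner [x], which is not null. *)
Lemma right_clopen_tiling_cover (R : realType) (n : nat) (E T : set 'rV[R]_n)
    (M : R) (x : 'rV[R]_n) :
  right_clopen E -> (forall y, E y -> forall i, `|y 0 i| <= M) ->
  tiling_of E T -> exists2 t, T t & E (x - t).
Proof.
move=> cE bE [_ dT _ cov]; apply: contrapT => nx.
(* This bounds the coordinates of every [t] whose translate meets a box of side at most 1 with
   lowest corner [x]. *)
pose N := \sum_i `|x 0 i| + 1 + M.
have [s Fs] := (finite_seqP _).1 (dT N).
have [d /andP[d0 d1] ds] : exists2 d : R, 0 < d <= 1 & forall t, t \in s ->
    forall y : 'rV[R]_n, (forall i, x 0 i <= y 0 i < x 0 i + d) -> ~ E (y - t).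
  have sT t : t \in s -> T t.
    move=> ts; have : [set` s] t by [].
    by rewrite -Fs => -[].
  elim: s sT {Fs} => [_|t s IH sT]; first by exists 1 => //; lra.
  have [u us|d /andP[d0 d1] ds] := IH; first by apply: sT; rewrite inE us orbT.
  have [r r0 rE] := right_clopen_translate t cE x.
  exists (Num.min d r) => [|u]; first by rewrite lt_min d0 r0 ge_min d1.
  have [md mr] : Num.min d r <= d /\ Num.min d r <= r by rewrite !ge_min !lexx orbT.
  rewrite inE => /orP[/eqP->|us] y xy.
    move=> Ey; apply: nx; exists t; first by apply: sT; rewrite mem_head.
    apply/translateE/(rE y); last exact/translateE.
    by move=> i; have := xy i; lra.
  by apply: (ds _ us) => i; have := xy i; lra.
move: cov => /eqP; rewrite gt_eqF//.
apply: (@lebesgue_outer_box_gt0 _ _ _ x (x + const_mx d)) => [i|y xy].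
  by rewrite !mxE ltrDl.
move=> [t Tt /translateE Eyt].
have xyd i : x 0 i <= y 0 i < x 0 i + d by have := xy i; rewrite !mxE.
apply: (ds t _ y xyd Eyt).
suff : [set` s] t by [].
rewrite -Fs; split => // i.
have := bE _ Eyt i; rewrite !mxE => bt.
have xN : `|x 0 i| <= \sum_i `|x 0 i|.
  by rewrite (bigD1 i)//= lerDl sumr_ge0.
have := xyd i; rewrite /N; move: bt xN d1.
by do 3![case: ler0P => ?]; lra.
Qed.

(** * The tile *)

Definition period (R : realType) (w : R) : R := 1 + 3 * w.

(** The pits 1 and 2 have size 2w, w, 2w, pit 3 has size 2w, 2w, w, and pit 4 has size w, 2w, 2w:
    the thin direction tells the three shapes apart. All the pits lie in x >= 1 + w or y >= 1 + w,
    away from the unit cube. *)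
Definition pit12 (R : realType) (w c x y z : R) : bool := let P := period w in
  [&& P - 2 * w <= x < P, P / 4 <= y < P / 4 + w & c <= z < c + 2 * w].
Definition pit1 (R : realType) (w : R) := pit12 w (period w / 4).
Definition pit2 (R : realType) (w : R) := pit12 w (3 * period w / 4).
Definition pit3 (R : realType) (w x y z : R) : bool := let P := period w in
  [&& P - 2 * w <= x < P, P - 2 * w <= y < P & P / 4 <= z < P / 4 + w].
(** Starting at [w] rather than 0 leaves a wall on both sides of the pit in its thin direction. *)
Definition pit4 (R : realType) (w x y z : R) : bool := let P := period w in
  [&& w <= x < 2 * w, P - 2 * w <= y < P & 3 * P / 4 <= z < 3 * P / 4 + 2 * w].

Definition main_part (R : realType) (w x y z : R) (o q : bool) : bool :=
  let P := period w in
  [&& o, 0 <= x < P, 0 <= y < P, 0 <= z < P &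
    ~~ (q && [|| pit1 w x y z, pit2 w x y z, pit3 w x y z | pit4 w x y z])].

Definition pin1 (R : realType) (w x y z : R) := pit1 w (x + period w) y z.
Definition pin2 (R : realType) (w x y z : R) := pit2 w (x + period w) y z.
Definition pin3 (R : realType) (w x y z : R) :=
  pit3 w (x + period w) (y + period w) z.
Definition pin4 (R : realType) (w x y z : R) :=
  pit4 w (x - period w) (y + period w) (z + period w / 2).

(* Membership in the tile in terms of the first three coordinates; [o] and [q]
   say that the remaining coordinates lie in the cell, resp. in the pits. *)
Definition in_tile (R : realType) (w x y z : R) (o q : bool) : bool :=
  main_part w x y z o q ||
  (q && [|| pin1 w x y z, pin2 w x y z, pin3 w x y z | pin4 w x y z]).

(* Heights met by no pit. *)
Definition free_height (R : realType) (w z : R) : bool := let P := period w in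
  [&& 0 <= z, z < P &
    [|| z < P / 4, P / 4 + 2 * w <= z < 3 * P / 4 | 3 * P / 4 + 2 * w <= z]].

(** A zone of heights containing pits has length 2w: its lowest quarter is left by going down w / 2,
    the rest by going up 2w. Both moves also take the bottom of a zone to a free height. *)
Lemma free_height_near (R : realType) (w z : R) : 0 < w -> w <= 1 / 40 ->
  0 <= z < period w -> free_height w (z - w / 2) || free_height w (z + 2 * w).
Proof.
rewrite /free_height /period; cbv zeta => w0 w1 /andP[z0 zP].
have [za|za] := ltP z (w / 2); first by apply/orP; right; lra.
have [zb|zb] := ltP z ((1 + 3 * w) / 4 + w / 2); first by apply/orP; left; lra.
have [zc|zc] := ltP z ((1 + 3 * w) / 4 + 2 * w + w / 2); first by apply/orP; right; lra.
have [ze|ze] := ltP z (3 * (1 + 3 * w) / 4 + w / 2); first by apply/orP; left; lra.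
have [zf|zf] := ltP z (3 * (1 + 3 * w) / 4 + 2 * w + w / 2); first by apply/orP; right; lra.
by apply/orP; left; lra.
Qed.

Lemma free_height_in_tile (R : realType) (w x y z : R) (q : bool) :
  0 < w -> w <= 1 / 40 -> 0 <= x < period w -> 0 <= y < period w ->
  free_height w z -> in_tile w x y z true q.
Proof.
move=> w0 w1 xP yP /and3P[z0 zP fz]; apply/orP; left; apply/and5P; split => //.
  by rewrite z0.
apply/negP => /andP[_]; move: fz; rewrite /period; cbv zeta => fz.
by case/or4P => /and3P[_ _]; move: fz; rewrite /period; cbv zeta; lra.
Qed.
(* What remains of the disjointness of the tile and its translate taking the point
   [(x, y, z)] of the tile to the corner [(a, b, c)] of a pit. *)
Definition blocked (R : realType) (w a b c x y z : R) (o q : bool) : Prop :=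
  forall dx dy dz, in_tile w (x + dx) (y + dy) (z + dz) o q ->
    in_tile w (a + dx) (b + dy) (c + dz) true true -> False.

(** Meant for a pin of width 2w in the thin direction of a pit: one of the two moves stays in the
    pin, while both take the corner of the pit into a wall. *)
Lemma shift_in_interval (R : realType) (w a s : R) : 0 < w ->
  a <= s < a + 2 * w -> a <= s - w / 2 < a + 2 * w \/ a <= s + w < a + 2 * w.
Proof. by move=> w0 /andP[? ?]; have [?|?] := ltP s (a + w); [right|left]; lra. Qed.

(** A vertical move by - w / 2 or 2w takes the point to a free height, and the corner of the pit as
    well, so the two copies would overlap. Hence only a pin can cover the corner. *)
Lemma blocked_main_part (R : realType) (w a b c x y z : R) (o q : bool) :
  0 < w -> w <= 1 / 40 -> 0 <= a < period w -> 0 <= b < period w ->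
  c = period w / 4 \/ c = 3 * period w / 4 ->
  blocked w a b c x y z o q -> ~~ main_part w x y z o q.
Proof.
move=> w0 w1 aP bP cE bl; apply/negP => /and5P[ho xP yP zP _].
have cF d : d = - (w / 2) \/ d = 2 * w -> free_height w (c + d).
  rewrite /free_height; move: cE; rewrite /period; cbv zeta.
  by case=> ->; case=> ->; apply/and3P; split; lra.
have zF d : d = - (w / 2) \/ d = 2 * w -> ~ free_height w (z + d).
  move=> dE; apply/negP; apply/negP => fz; apply: (bl 0 0 d).
    by rewrite !addr0 ho; exact: free_height_in_tile.
  by rewrite !addr0; apply: free_height_in_tile => //; exact: cF.
have /orP[/zF|/zF] := free_height_near w0 w1 zP; first by apply; left.
by apply; right.
Qed.

(** * Which pin fills which pit *)

Lemma in_tile_pin1 (R : realType) (w x y z : R) (o : bool) :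
  pin1 w x y z -> in_tile w x y z o true.
Proof. by rewrite /in_tile => ->; rewrite orbT. Qed.

Lemma in_tile_pin2 (R : realType) (w x y z : R) (o : bool) :
  pin2 w x y z -> in_tile w x y z o true.
Proof. by rewrite /in_tile => ->; rewrite !orbT. Qed.

Lemma in_tile_pin3 (R : realType) (w x y z : R) (o : bool) :
  pin3 w x y z -> in_tile w x y z o true.
Proof. by rewrite /in_tile => ->; rewrite !orbT. Qed.

Lemma in_tile_pin4 (R : realType) (w x y z : R) (o : bool) :
  pin4 w x y z -> in_tile w x y z o true.
Proof. by rewrite /in_tile => ->; rewrite !orbT. Qed.

Ltac in_main_part :=
  apply/orP; left; apply/and5P; split => //;
  [by rewrite /period; lra | by rewrite /period; lra | by rewrite /period; lra |
   apply/negP => /andP[_]; case/or4P => /and3P[];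
   rewrite /period; cbv zeta; lra].

Ltac in_pin :=
  rewrite /pin1 /pin2 /pin3 /pin4 /pit1 /pit2 /pit3 /pit4 /pit12;
  cbv zeta; apply/and3P; split; lra.

Ltac unfold_pin :=
  rewrite /pin1 /pin2 /pin3 /pin4 /pit1 /pit2 /pit3 /pit4 /pit12;
  cbv zeta => /and3P[/andP[x1 x2] /andP[y1 y2] /andP[z1 z2]].

(** The pins 3 and 4 are too wide in the direction [y]. A pin 1 or 2 must have its lowest corner at
    that of the pit, since otherwise it would cut into a wall. *)
Lemma blocked_pit1 (R : realType) (w x y z : R) (o q : bool) :
  0 < w -> w <= 1 / 40 -> in_tile w x y z o q ->
  blocked w (period w - 2 * w) (period w / 4) (period w / 4) x y z o q ->
  [/\ q, x = - (2 * w), y = period w / 4 &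
      z = period w / 4 \/ z = 3 * period w / 4].
Proof.
move=> w0 w1 tx bl.
have nmain : ~~ main_part w x y z o q.
  by apply: (blocked_main_part w0 w1 _ _ _ bl); rewrite /period; [lra|lra|left].
move: tx; rewrite /in_tile (negbTE nmain)/= => /andP[q1]; rewrite q1 in bl *.
(* The tile bounds the pit below its corner in each direction, and at distance [w] above it in the
   thin direction. The covering point cannot stay in the tile under any of these moves. *)
have wall_x d : - (2 * w) <= d < 0 ->
    in_tile w (period w - 2 * w + d) (period w / 4) (period w / 4) true true.
  by move=> ?; in_main_part.
have wall_y d : - w <= d < 0 \/ d = w ->
    in_tile w (period w - 2 * w) (period w / 4 + d) (period w / 4) true true.
  by case=> ?; in_main_part.
have wall_z d : - (2 * w) <= d < 0 ->
    in_tile w (period w - 2 * w) (period w / 4) (period w / 4 + d) true true.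
  by move=> ?; in_main_part.
have nx d : - (2 * w) <= d < 0 -> ~ in_tile w (x + d) y z o true.
  by move=> hd tx; apply: (bl d 0 0); rewrite !addr0//; exact: wall_x.
have ny d : - w <= d < 0 \/ d = w -> ~ in_tile w x (y + d) z o true.
  by move=> hd ty; apply: (bl 0 d 0); rewrite !addr0//; exact: wall_y.
have nz d : - (2 * w) <= d < 0 -> ~ in_tile w x y (z + d) o true.
  by move=> hd tz; apply: (bl 0 0 d); rewrite !addr0//; exact: wall_z.
case/or4P; unfold_pin.
- split => //.
  + have [xe|xe] := leP x (- (2 * w)); first by lra.
    (* This move takes the covering point down to the lowest face of the pin. *)
    case: (nx (- (2 * w) - x)); first lra.
    by apply: in_tile_pin1; in_pin.
  + have [ye|ye] := leP y (period w / 4); first by lra.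
    case: (ny (period w / 4 - y)); first by left; lra.
    by apply: in_tile_pin1; in_pin.
  + have [ze|ze] := leP z (period w / 4); first by left; lra.
    case: (nz (period w / 4 - z)); first by lra.
    by apply: in_tile_pin1; in_pin.
- split => //.
  + have [xe|xe] := leP x (- (2 * w)); first by lra.
    case: (nx (- (2 * w) - x)); first lra.
    by apply: in_tile_pin2; in_pin.
  + have [ye|ye] := leP y (period w / 4); first by lra.
    case: (ny (period w / 4 - y)); first by left; lra.
    by apply: in_tile_pin2; in_pin.
  + have [ze|ze] := leP z (3 * period w / 4); first by right; lra.
    case: (nz (3 * period w / 4 - z)); first by lra.
    by apply: in_tile_pin2; in_pin.
- exfalso; have /(shift_in_interval w0)[yd|yd] : - (2 * w) <= y < - (2 * w) + 2 * w by lra.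
  + case: (ny (- (w / 2))); first by left; lra.
    by apply: in_tile_pin3; in_pin.
  + case: (ny w); first by right.
    by apply: in_tile_pin3; in_pin.
- exfalso; have /(shift_in_interval w0)[yd|yd] : - (2 * w) <= y < - (2 * w) + 2 * w by lra.
  + case: (ny (- (w / 2))); first by left; lra.
    by apply: in_tile_pin4; in_pin.
  + case: (ny w); first by right.
    by apply: in_tile_pin4; in_pin.
Qed.

(** As for pit 1, with [z] as thin direction: the other three pins have width 2w there. *)
Lemma blocked_pit3 (R : realType) (w x y z : R) (o q : bool) :
  0 < w -> w <= 1 / 40 -> in_tile w x y z o q ->
  blocked w (period w - 2 * w) (period w - 2 * w) (period w / 4) x y z o q ->
  [/\ q, x = - (2 * w), y = - (2 * w) & z = period w / 4].
Proof.
move=> w0 w1 tx bl.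
have nmain : ~~ main_part w x y z o q.
  by apply: (blocked_main_part w0 w1 _ _ _ bl); rewrite /period; [lra|lra|left].
move: tx; rewrite /in_tile (negbTE nmain)/= => /andP[q1]; rewrite q1 in bl *.
have wall_x d : - (2 * w) <= d < 0 ->
    in_tile w (period w - 2 * w + d) (period w - 2 * w) (period w / 4) true true.
  by move=> ?; in_main_part.
have wall_y d : - (2 * w) <= d < 0 ->
    in_tile w (period w - 2 * w) (period w - 2 * w + d) (period w / 4) true true.
  by move=> ?; in_main_part.
have wall_z d : - w <= d < 0 \/ d = w ->
    in_tile w (period w - 2 * w) (period w - 2 * w) (period w / 4 + d) true true.
  by case=> ?; in_main_part.
have nx d : - (2 * w) <= d < 0 -> ~ in_tile w (x + d) y z o true.
  by move=> hd tx; apply: (bl d 0 0); rewrite !addr0//; exact: wall_x.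
have ny d : - (2 * w) <= d < 0 -> ~ in_tile w x (y + d) z o true.
  by move=> hd ty; apply: (bl 0 d 0); rewrite !addr0//; exact: wall_y.
have nz d : - w <= d < 0 \/ d = w -> ~ in_tile w x y (z + d) o true.
  by move=> hd tz; apply: (bl 0 0 d); rewrite !addr0//; exact: wall_z.
case/or4P; unfold_pin.
- exfalso; have /(shift_in_interval w0)[zd|zd] : period w / 4 <= z < period w / 4 + 2 * w by lra.
  + case: (nz (- (w / 2))); first by left; lra.
    by apply: in_tile_pin1; in_pin.
  + case: (nz w); first by right.
    by apply: in_tile_pin1; in_pin.
- exfalso; have /(shift_in_interval w0)[zd|zd] : 3 * period w / 4 <= z < 3 * period w / 4 + 2 * w by lra.
  + case: (nz (- (w / 2))); first by left; lra.
    by apply: in_tile_pin2; in_pin.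
  + case: (nz w); first by right.
    by apply: in_tile_pin2; in_pin.
- split => //.
  + have [xe|xe] := leP x (- (2 * w)); first by lra.
    case: (nx (- (2 * w) - x)); first by lra.
    by apply: in_tile_pin3; in_pin.
  + have [ye|ye] := leP y (- (2 * w)); first by lra.
    case: (ny (- (2 * w) - y)); first by lra.
    by apply: in_tile_pin3; in_pin.
  + have [ze|ze] := leP z (period w / 4); first by lra.
    case: (nz (period w / 4 - z)); first by left; lra.
    by apply: in_tile_pin3; in_pin.
- exfalso; have /(shift_in_interval w0)[zd|zd] : period w / 4 <= z < period w / 4 + 2 * w by lra.
  + case: (nz (- (w / 2))); first by left; lra.
    by apply: in_tile_pin4; in_pin.
  + case: (nz w); first by right.
    by apply: in_tile_pin4; in_pin.
Qed.

(** As for pit 1, with [x] as thin direction: the other three pins have width 2w there. *)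
Lemma blocked_pit4 (R : realType) (w x y z : R) (o q : bool) :
  0 < w -> w <= 1 / 40 -> in_tile w x y z o q ->
  blocked w (w) (period w - 2 * w) (3 * period w / 4) x y z o q ->
  [/\ q, x = period w + w, y = - (2 * w) & z = period w / 4].
Proof.
move=> w0 w1 tx bl.
have nmain : ~~ main_part w x y z o q.
  by apply: (blocked_main_part w0 w1 _ _ _ bl); rewrite /period; [lra|lra|right].
move: tx; rewrite /in_tile (negbTE nmain)/= => /andP[q1]; rewrite q1 in bl *.
have wall_x d : - w <= d < 0 \/ d = w ->
    in_tile w (w + d) (period w - 2 * w) (3 * period w / 4) true true.
  by case=> ?; in_main_part.
have wall_y d : - (2 * w) <= d < 0 ->
    in_tile w (w) (period w - 2 * w + d) (3 * period w / 4) true true.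
  by move=> ?; in_main_part.
have wall_z d : - (2 * w) <= d < 0 ->
    in_tile w (w) (period w - 2 * w) (3 * period w / 4 + d) true true.
  by move=> ?; in_main_part.
have nx d : - w <= d < 0 \/ d = w -> ~ in_tile w (x + d) y z o true.
  by move=> hd tx; apply: (bl d 0 0); rewrite !addr0//; exact: wall_x.
have ny d : - (2 * w) <= d < 0 -> ~ in_tile w x (y + d) z o true.
  by move=> hd ty; apply: (bl 0 d 0); rewrite !addr0//; exact: wall_y.
have nz d : - (2 * w) <= d < 0 -> ~ in_tile w x y (z + d) o true.
  by move=> hd tz; apply: (bl 0 0 d); rewrite !addr0//; exact: wall_z.
case/or4P; unfold_pin.
- exfalso; have /(shift_in_interval w0)[xd|xd] : - (2 * w) <= x < - (2 * w) + 2 * w by lra.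
  + case: (nx (- (w / 2))); first by left; lra.
    by apply: in_tile_pin1; in_pin.
  + case: (nx w); first by right.
    by apply: in_tile_pin1; in_pin.
- exfalso; have /(shift_in_interval w0)[xd|xd] : - (2 * w) <= x < - (2 * w) + 2 * w by lra.
  + case: (nx (- (w / 2))); first by left; lra.
    by apply: in_tile_pin2; in_pin.
  + case: (nx w); first by right.
    by apply: in_tile_pin2; in_pin.
- exfalso; have /(shift_in_interval w0)[xd|xd] : - (2 * w) <= x < - (2 * w) + 2 * w by lra.
  + case: (nx (- (w / 2))); first by left; lra.
    by apply: in_tile_pin3; in_pin.
  + case: (nx w); first by right.
    by apply: in_tile_pin3; in_pin.
- split => //.
  + have [xe|xe] := leP x (period w + w); first by lra.
    case: (nx (period w + w - x)); first by left; lra.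
    by apply: in_tile_pin4; in_pin.
  + have [ye|ye] := leP y (- (2 * w)); first by lra.
    case: (ny (- (2 * w) - y)); first by lra.
    by apply: in_tile_pin4; in_pin.
  + have [ze|ze] := leP z (period w / 4); first by lra.
    case: (nz (period w / 4 - z)); first by lra.
    by apply: in_tile_pin4; in_pin.
Qed.

(** * The tile as a set of row vectors *)

Definition ix0 (n : nat) : 'I_n.+3 := @Ordinal n.+3 0 isT.
Definition ix1 (n : nat) : 'I_n.+3 := @Ordinal n.+3 1 isT.
Definition ix2 (n : nat) : 'I_n.+3 := @Ordinal n.+3 2 isT.

Variant ix_spec (n : nat) : 'I_n.+3 -> Prop :=
  | Ix0 : ix_spec (ix0 n)
  | Ix1 : ix_spec (ix1 n)
  | Ix2 : ix_spec (ix2 n)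
  | IxOther (i : 'I_n.+3) of (2 < i)%N : ix_spec i.

Lemma ixP (n : nat) (i : 'I_n.+3) : ix_spec i.
Proof.
case: (ltnP 2 i) => [|i2]; first exact: IxOther.
case: i i2 => -[|[|[|//]]] h _.
- by rewrite (_ : Ordinal h = ix0 n); [exact: Ix0 | exact: val_inj].
- by rewrite (_ : Ordinal h = ix1 n); [exact: Ix1 | exact: val_inj].
- by rewrite (_ : Ordinal h = ix2 n); [exact: Ix2 | exact: val_inj].
Qed.

Definition vec (R : realType) (n : nat) (a b c d : R) : 'rV[R]_n.+3 :=
  \row_i (match val i with 0%N => a | 1%N => b | 2%N => c | _ => d end).

Lemma vec0E (R : realType) (n : nat) (a b c d : R) : vec n a b c d 0 (ix0 n) = a.
Proof. by rewrite mxE. Qed.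
Lemma vec1E (R : realType) (n : nat) (a b c d : R) : vec n a b c d 0 (ix1 n) = b.
Proof. by rewrite mxE. Qed.
Lemma vec2E (R : realType) (n : nat) (a b c d : R) : vec n a b c d 0 (ix2 n) = c.
Proof. by rewrite mxE. Qed.
Lemma vec_otherE (R : realType) (n : nat) (a b c d : R) (i : 'I_n.+3) :
  (2 < i)%N -> vec n a b c d 0 i = d.
Proof. by rewrite mxE; case: i => -[|[|[]]]. Qed.
Definition vecE := (vec0E, vec1E, vec2E).

Definition others_in (R : realType) (n : nat) (lo hi : R) (x : 'rV[R]_n.+3) : bool :=
  [forall i : 'I_n.+3, (2 < i)%N ==> (lo <= x 0 i < hi)].

Lemma others_inP (R : realType) (n : nat) (lo hi : R) (x : 'rV[R]_n.+3) :
  reflect (forall i : 'I_n.+3, (2 < i)%N -> lo <= x 0 i < hi) (others_in lo hi x).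
Proof. by apply: (iffP forallP) => h i; apply/implyP/h. Qed.

Definition tile (R : realType) (n : nat) (w : R) : set 'rV[R]_n.+3 :=
  [set x : 'rV[R]_n.+3 | in_tile w (x 0 (ix0 n)) (x 0 (ix1 n)) (x 0 (ix2 n))
    (others_in 0 (period w) x)
    (others_in (period w / 4) (period w / 4 + w) x)].

Lemma brick_boxE (R : realType) (n : nat) (a a' b b' c c' d d' s0 s1 s2 : R) :
  [set x : 'rV[R]_n.+3 | others_in d d' x &&
     [&& a <= x 0 (ix0 n) + s0 < a', b <= x 0 (ix1 n) + s1 < b' &
         c <= x 0 (ix2 n) + s2 < c']] =
  box (vec n (a - s0) (b - s1) (c - s2) d) (vec n (a' - s0) (b' - s1) (c' - s2) d').
Proof.
apply/seteqP; split => [x /= /andP[/others_inP xo /and3P[x0 x1 x2]] i|x xi /=].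
  case: (ixP i) => [|||j j2]; rewrite ?vecE ?vec_otherE//; [lra..|exact: xo].
apply/andP; split.
  by apply/others_inP => i i2; have := xi i; rewrite !vec_otherE.
by have := xi (ix0 n); have := xi (ix1 n); have := xi (ix2 n); rewrite !vecE; lra.
Qed.

(** The tile is a Boolean combination of boxes. This principle gives both its measurability and its
    right-clopenness. *)
Lemma tile_boxes (R : realType) (n : nat) (w : R)
    (P : set 'rV[R]_n.+3 -> Prop) :
  (forall a b, P (box a b)) -> (forall A, P A -> P (~` A)) ->
  (forall A B, P A -> P B -> P (A `&` B)) -> P (@tile R n w).
Proof.
move=> Pbox PC PI.
have PU A B : P A -> P B -> P (A `|` B).
  by move=> PA PB; rewrite -(setCK A) -(setCK B) -setCI; apply/PC/PI; exact: PC.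
pose o (x : 'rV[R]_n.+3) := others_in 0 (period w) x.
pose q (x : 'rV[R]_n.+3) := others_in (period w / 4) (period w / 4 + w) x.
pose at3 (f : R -> R -> R -> bool) (x : 'rV[R]_n.+3) :=
  f (x 0 (ix0 n)) (x 0 (ix1 n)) (x 0 (ix2 n)).
have Pbrick a a' b b' c c' d d' s0 s1 s2 : P [set x | others_in d d' x &&
     [&& a <= x 0 (ix0 n) + s0 < a', b <= x 0 (ix1 n) + s1 < b' &
         c <= x 0 (ix2 n) + s2 < c']].
  by rewrite brick_boxE.
have Pcell : P [set x | o x && at3 (fun x y z => [&& 0 <= x < period w,
    0 <= y < period w & 0 <= z < period w]) x].
  have := Pbrick 0 (period w) 0 (period w) 0 (period w) 0 (period w) 0 0 0.
  by congr (P _); apply/funext => x /=; rewrite !addr0.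
pose is_brick (f : R -> R -> R -> bool) := exists a a' b b' c c' : R, forall x y z,
      f x y z = [&& a <= x < a', b <= y < b' & c <= z < c'].
have [k1 k2 k3 k4] : [/\ is_brick (pit1 w), is_brick (pit2 w), is_brick (pit3 w) & is_brick (pit4 w)].
  by split; do 6!eexists.
have Pat f s0 s1 s2 : is_brick f ->
    P [set x | q x && at3 (fun x y z => f (x + s0) (y + s1) (z + s2)) x].
  move=> [a [a' [b [b' [c [c' fE]]]]]].
  have := Pbrick a a' b b' c c' (period w / 4) (period w / 4 + w) s0 s1 s2.
  by congr (P _); apply/funext => x /=; rewrite /at3 fE.
have Ppit f : is_brick f -> P [set x | q x && at3 f x].
  move=> /(Pat f 0 0 0); congr (P _); apply/funext => x /=.
  by rewrite /at3 !addr0.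
have -> : @tile R n w = ([set x | o x && at3 (fun x y z => [&& 0 <= x < period w,
      0 <= y < period w & 0 <= z < period w]) x] `&`
    ~` ([set x | q x && at3 (pit1 w) x] `|` [set x | q x && at3 (pit2 w) x] `|`
        [set x | q x && at3 (pit3 w) x] `|` [set x | q x && at3 (pit4 w) x])) `|`
    ([set x | q x && at3 (pin1 w) x] `|` [set x | q x && at3 (pin2 w) x] `|`
     [set x | q x && at3 (pin3 w) x] `|` [set x | q x && at3 (pin4 w) x]).
  apply/predeqP => x; rewrite /tile /in_tile /main_part /at3 /= -/(o x) -/(q x).
  split.
    case/orP => [/and5P[-> -> -> -> /negP n1]|/andP[-> /or4P[]->]]; last 4 first.
    - by right; left; left; left.
    - by right; left; left; right.
    - by right; left; right.
    - by right; right.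
    left; split => // -[[[]|]|] /andP[qx px]; apply: n1; rewrite qx px ?orbT//.
  case=> [[/andP[-> /and3P[-> -> ->]] n1]|].
    apply/orP; left => /=; apply/negP => /andP[qx].
    by case/or4P => px; apply: n1; rewrite qx px;
      [left; left; left|left; left; right|left; right|right].
  by case=> [[[]|]|] /andP[-> ->]; rewrite ?orbT.
have [b1 b2 b3 b4] : [/\ P [set x | q x && at3 (pit1 w) x],
    P [set x | q x && at3 (pit2 w) x], P [set x | q x && at3 (pit3 w) x] &
    P [set x | q x && at3 (pit4 w) x]].
  by split; exact: Ppit.
have [c1 c2 c3 c4] : [/\ P [set x | q x && at3 (pin1 w) x],
    P [set x | q x && at3 (pin2 w) x], P [set x | q x && at3 (pin3 w) x] &
    P [set x | q x && at3 (pin4 w) x]].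
  split.
  - have := Pat _ (period w) 0 0 k1.
    by congr (P _); apply/funext => x; rewrite /at3 /pin1 /= !addr0.
  - have := Pat _ (period w) 0 0 k2.
    by congr (P _); apply/funext => x; rewrite /at3 /pin2 /= !addr0.
  - have := Pat _ (period w) (period w) 0 k3.
    by congr (P _); apply/funext => x; rewrite /at3 /pin3 /= !addr0.
  - by apply: (Pat _ (- period w) (period w) (period w / 2) k4).
apply: (PU); [apply: (PI); [exact: Pcell|apply: (PC)]|].
- by apply: (PU); [apply: (PU); [apply: (PU)|]|].
- by apply: (PU); [apply: (PU); [apply: (PU)|]|].
Qed.

Lemma tile_measurable (R : realType) (n : nat) (w : R) :
  lebesgue_measurable (@tile R n w).
Proof.
apply: tile_boxes; first exact: box_measurable.
- exact: caratheodory_measurable_setC.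
- exact: caratheodory_measurable_setI.
Qed.

Lemma right_clopen_tile (R : realType) (n : nat) (w : R) : right_clopen (@tile R n w).
Proof.
apply: tile_boxes; first exact: right_clopen_box.
- exact: right_clopenC.
- exact: right_clopenI.
Qed.

Lemma cube_sub_tile (R : realType) (n : nat) (w : R) : 0 < w ->
  [set x : 'rV[R]_n.+3 | forall i, 0 <= x 0 i <= 1] `<=` tile w.
Proof.
move=> w0 x x01; have := x01 (ix0 n); have := x01 (ix1 n); have := x01 (ix2 n).
move=> z01 y01 x01'; apply/orP; left; apply/and5P.
split; [|by rewrite /period; lra..|].
  by apply/others_inP => i _; have := x01 i; rewrite /period; lra.
apply/negP => /andP[_]; case/or4P => /and3P[];
  by rewrite /period; cbv zeta; lra.
Qed.

Lemma others_inW (R : realType) (n : nat) (w : R) (x : 'rV[R]_n.+3) : 0 < w ->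
  others_in (period w / 4) (period w / 4 + w) x -> others_in 0 (period w) x.
Proof.
move=> w0 /others_inP xq; apply/others_inP => i i2.
by have := xq i i2; rewrite /period; lra.
Qed.

Lemma in_tile_range (R : realType) (w x y z : R) (o q : bool) : 0 < w -> w <= 1 / 40 ->
  in_tile w x y z o q ->
  [/\ - (2 * w) <= x < period w + 2 * w, - (2 * w) <= y < period w,
      0 <= z < period w & o || q].
Proof.
move=> w0 w1; case/orP => [/and5P[-> xP yP zP _]|/andP[-> pin]].
  by split => //; lra.
rewrite orbT; split => //; move: pin; case/or4P => /and3P[];
  by rewrite /period; cbv zeta; lra.
Qed.

Lemma tile_range (R : realType) (n : nat) (w : R) (x : 'rV[R]_n.+3) :
  0 < w -> w <= 1 / 40 -> tile w x ->
  [/\ - (2 * w) <= x 0 (ix0 n) < period w + 2 * w,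
      - (2 * w) <= x 0 (ix1 n) < period w,
      0 <= x 0 (ix2 n) < period w & others_in 0 (period w) x].
Proof.
move=> w0 w1 /(in_tile_range w0 w1)[xP yP zP oq]; split => //.
by case/orP: oq => //; exact: others_inW.
Qed.

(** The pin 4 extends to P + 2w = 1 + 5w in the first coordinate. *)
Lemma tile_bounded (R : realType) (n : nat) (w : R) (x : 'rV[R]_n.+3) :
  0 < w -> w <= 1 / 40 -> tile w x -> forall i, - (5 * w) <= x 0 i <= 1 + 5 * w.
Proof.
move=> w0 w1 /(tile_range w0 w1)[xP yP zP /others_inP oP] i.
case: (ixP i) => [|||j j2]; move: xP yP zP; rewrite /period; [lra..|].
by have := oP _ j2; rewrite /period; lra.
Qed.

(** * Lattice tilings *)

Lemma lattice0 (R : realType) (n : nat) (A : 'M[R]_n) : lattice A 0.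
Proof. by exists 0; rewrite map_mx0 mul0mx. Qed.

Lemma latticeD (R : realType) (n : nat) (A : 'M[R]_n) (s t : 'rV[R]_n) :
  lattice A s -> lattice A t -> lattice A (s + t).
Proof.
move=> [k ->] [l ->]; exists (k + l); rewrite -mulmxDl; congr (_ *m _).
by apply/rowP => i; rewrite !mxE intrD.
Qed.

Lemma latticeN (R : realType) (n : nat) (A : 'M[R]_n) (s : 'rV[R]_n) :
  lattice A s -> lattice A (- s).
Proof.
move=> [k ->]; exists (- k); rewrite -mulNmx; congr (_ *m _).
by apply/rowP => i; rewrite !mxE intrN.
Qed.

Lemma others_in_vec (R : realType) (n : nat) (lo hi a b c d : R) :
  lo <= d < hi -> others_in lo hi (vec n a b c d).
Proof. by move=> dP; apply/others_inP => i i2; rewrite vec_otherE. Qed.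

Lemma others_in_add (R : realType) (n : nat) (lo hi a b c : R) (x : 'rV[R]_n.+3) :
  others_in lo hi (x + vec n a b c 0) = others_in lo hi x.
Proof.
apply: eq_forallb => i; case: (ltnP 2 i) => //= i2.
by rewrite mxE vec_otherE// addr0.
Qed.

Lemma row_addE (R : realType) (n : nat) (x y : 'rV[R]_n) i :
  (x + y) 0 i = x 0 i + y 0 i.
Proof. by rewrite mxE. Qed.

Lemma row_oppE (R : realType) (n : nat) (x : 'rV[R]_n) i : (- x) 0 i = - x 0 i.
Proof. by rewrite mxE. Qed.

Lemma lattice_disjoint (R : realType) (n : nat) (w : R) (A : 'M[R]_n.+3) x t :
  tiling_of (@tile R n w) (lattice A) ->
  lattice A t -> tile w x -> tile w (x - t) -> t = 0.
Proof.
move=> tA At Ex Ext.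
apply: (right_clopen_tiling_disjoint (@right_clopen_tile R n w) tA At (lattice0 A) Ext).
by rewrite subr0.
Qed.

(* [vec a b c (P / 4)] is meant to be the lowest corner of a pit. *)
Lemma pit_filled (R : realType) (n : nat) (w : R) (A : 'M[R]_n.+3) (a b c : R) :
  0 < w -> w <= 1 / 40 -> tiling_of (@tile R n w) (lattice A) ->
  0 <= a < period w -> 0 <= b < period w -> 0 <= c < period w ->
  ~~ in_tile w a b c true true ->
  exists2 t, lattice A t &
    let x := vec n a b c (period w / 4) - t in
    exists o q, [/\ in_tile w (x 0 (ix0 n)) (x 0 (ix1 n)) (x 0 (ix2 n)) o q,
      blocked w a b c (x 0 (ix0 n)) (x 0 (ix1 n)) (x 0 (ix2 n)) o q &
      q -> forall i : 'I_n.+3, (2 < i)%N -> t 0 i = 0].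
Proof.
move=> w0 w1 tA aP bP cP nabc; set k := vec n a b c (period w / 4).
have bE y : @tile R n w y -> forall i, `|y 0 i| <= 2.
  move=> /(tile_bounded w0 w1) yb i; have := yb i.
  by rewrite ler_norml; lra.
have [t At Et] := right_clopen_tiling_cover k (@right_clopen_tile R n w) bE tA.
exists t => //=; set x := k - t in Et *.
have xE : x = k - t by []; clearbody x.
have tile_kE d0 d1 d2 : tile w (k + vec n d0 d1 d2 0) <->
    in_tile w (a + d0) (b + d1) (c + d2) true true.
  rewrite /tile /= !others_in_add !others_in_vec; [|rewrite /period; lra..].
  by rewrite !row_addE !vecE.
(* The corner [k] is outside the tile, but [k - t] is inside. *)
have t_neq0 : t <> 0.
  move=> t0; have := (tile_kE 0 0 0).1; rewrite !addr0 (negbTE nabc) => h.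
  suff : false by [].
  apply: h; rewrite (_ : vec _ _ _ _ _ = 0) ?addr0; last first.
    by apply/rowP => i; rewrite !mxE; case: (val i) => [|[|[]]].
  by move: Et; rewrite xE t0 subr0.
have no_overlap d : tile w (x + d) -> tile w (k + d) -> False.
  move=> Exd Ekd; apply: t_neq0; apply: (lattice_disjoint tA At Ekd).
  by rewrite (_ : k + d - t = x + d)// xE addrAC.
exists (others_in 0 (period w) x), (others_in (period w / 4) (period w / 4 + w) x).
split => // [dx dy dz xd kd|/others_inP qx i i2].
  apply: (no_overlap (vec n dx dy dz 0)); last exact/tile_kE.
  by rewrite /tile /= !others_in_add !row_addE !vecE.
have ti : x 0 i + t 0 i = period w / 4.
  by rewrite -row_addE xE subrK vec_otherE.
have [xi|xi] := leP (x 0 i) (period w / 4).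
  by have := qx i i2; lra.
exfalso.
(* Were the pin displaced in another direction [i], this move would keep [x] in it and push [k] out
   of the pits but not out of the cell, that is, into the main part. *)
pose d : 'rV[R]_n.+3 := \row_j (if j == i then period w / 4 - x 0 i else 0).
have [d0 d1 d2] : [/\ d 0 (ix0 n) = 0, d 0 (ix1 n) = 0 & d 0 (ix2 n) = 0].
  by split; rewrite mxE; case: eqP => // ii; move: i2; rewrite -ii.
apply: (no_overlap d).
  have xd lo hi : lo <= period w / 4 < hi -> lo <= x 0 i < hi ->
      others_in lo hi (x + d) = others_in lo hi x.
    move=> lohi xlohi; apply: eq_forallb => j; rewrite row_addE [d _ _]mxE.
    case: eqP => [->|_]; last by rewrite addr0.
    by rewrite addrC subrK lohi xlohi.
  have xi4 := qx i i2.
  move: Et; rewrite /tile /= !row_addE d0 d1 d2 !addr0.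
  by rewrite !xd//; move: xi4; rewrite /period; lra.
have oT : others_in 0 (period w) (k + d).
  apply/others_inP => j j2; rewrite row_addE vec_otherE// [d _ _]mxE.
  have := qx i i2; case: eqP => _; rewrite /period; lra.
have qF : others_in (period w / 4) (period w / 4 + w) (k + d) = false.
  apply/negP => /others_inP/(_ i i2); rewrite row_addE vec_otherE// [d _ _]mxE eqxx.
  by lra.
rewrite /tile /= oT qF !row_addE d0 d1 d2 !addr0 !vecE.
by apply/orP; left; apply/and5P.
Qed.

Ltac pit_corner :=
  apply/negP => /orP[/and5P[_ _ _ _ /negP]|/andP[_]];
  [apply; rewrite /pit1 /pit2 /pit3 /pit4 /pit12 /period; cbv zeta; lra
  |by case/or4P => /and3P[]; rewrite /period; cbv zeta; lra].

Lemma pit1_corner (R : realType) (w : R) : 0 < w -> w <= 1 / 40 ->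
  ~~ in_tile w (period w - 2 * w) (period w / 4) (period w / 4) true true.
Proof. move=> w0 w1; pit_corner. Qed.

Lemma pit3_corner (R : realType) (w : R) : 0 < w -> w <= 1 / 40 ->
  ~~ in_tile w (period w - 2 * w) (period w - 2 * w) (period w / 4) true true.
Proof. move=> w0 w1; pit_corner. Qed.

Lemma pit4_corner (R : realType) (w : R) : 0 < w -> w <= 1 / 40 ->
  ~~ in_tile w w (period w - 2 * w) (3 * period w / 4) true true.
Proof. move=> w0 w1; pit_corner. Qed.

(* With [t1], [t3], [t4] the translations filling the pits 1, 3, 4, the lattice
   contains [2 * t1 - t3 + t4], which is half a period in the third direction. *)
Lemma tile_not_lattice (R : realType) (n : nat) (w : R) (A : 'M[R]_n.+3) :
  0 < w -> w <= 1 / 40 -> ~ tiling_of (@tile R n w) (lattice A).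
Proof.
move=> w0 w1 tA.
have fill a b c := @pit_filled R n w A a b c w0 w1 tA.
have [c1 c2 c3 c4] : [/\ 0 <= period w - 2 * w < period w,
    0 <= period w / 4 < period w, 0 <= w < period w &
    0 <= 3 * period w / 4 < period w] by split; rewrite /period; lra.
have [t1 A1 [e1 [q1 [T1 B1 Z1]]]] := fill _ _ _ c1 c2 c2 (pit1_corner w0 w1).
have [t3 A3 [e3 [q3 [T3 B3 Z3]]]] := fill _ _ _ c1 c1 c2 (pit3_corner w0 w1).
have [t4 A4 [e4 [q4 [T4 B4 Z4]]]] := fill _ _ _ c3 c1 c4 (pit4_corner w0 w1).
have [/Z1 {}Z1] := blocked_pit1 w0 w1 T1 B1.
have [/Z3 {}Z3] := blocked_pit3 w0 w1 T3 B3.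
have [/Z4 {}Z4] := blocked_pit4 w0 w1 T4 B4.
rewrite !row_addE !row_oppE !vecE => x4 y4 z4 x3 y3 z3 x1 y1 z1.
pose s := t1 + t1 - t3 + t4.
have As : lattice A s by do !apply: latticeD => //; exact: latticeN.
have sE i : s 0 i = t1 0 i + t1 0 i - t3 0 i + t4 0 i by rewrite !mxE.
have s0 : s 0 (ix0 n) = 0 by rewrite sE; lra.
have s1 : s 0 (ix1 n) = 0 by rewrite sE; lra.
(* The third coordinate of [t1] is 0 or - P / 2, so its double is 0 or - P; [t3] contributes 0 and
   [t4] contributes P / 2. *)
have s2 : s 0 (ix2 n) = period w / 2 \/ s 0 (ix2 n) = - (period w / 2).
  by rewrite sE; case: z1 => ?; [left|right]; lra.
have sV : - s = vec n 0 0 (- s 0 (ix2 n)) 0.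
  apply/rowP => i; rewrite mxE; case: (ixP i) => [|||j j2];
    rewrite ?vecE ?vec_otherE ?s0 ?s1 ?oppr0//.
  by rewrite sE Z1// Z3// Z4// addr0 subr0 addr0 oppr0.
have in_column z : free_height w z -> tile w (vec n 0 0 z 0).
  move=> fz; rewrite /tile /= !vecE.
  have -> : others_in 0 (period w) (vec n 0 0 z 0) by apply: others_in_vec; lra.
  by apply: free_height_in_tile => //; lra.
have vecD z : vec n 0 0 z 0 - s = vec n 0 0 (z - s 0 (ix2 n)) 0.
  apply/rowP => i; rewrite sV row_addE; case: (ixP i) => [|||j j2];
    rewrite ?vecE ?vec_otherE ?addr0//.
have s_eq0 z : free_height w z -> free_height w (z - s 0 (ix2 n)) -> False.
  move=> fz fzs; have sz : s = 0.
    apply: (lattice_disjoint tA As (in_column _ fz)).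
    by rewrite vecD; exact: in_column.
  have := s2; rewrite sz mxE /period; lra.
(* The tops P / 4 + 2w and 3P / 4 + 2w of the two zones of pits are free heights, half a period
   apart. *)
case: s2 => s2.
  apply: (s_eq0 (3 * period w / 4 + 2 * w)); rewrite ?s2 /free_height /period;
  cbv zeta; lra.
apply: (s_eq0 (period w / 4 + 2 * w)); rewrite ?s2 /free_height /period;
  cbv zeta; lra.
Qed.

(** * A tiling *)

(* The column above the cell [(i, j)] is raised by half a period when [raised (i - j)]. *)
Definition raised (d : int) : bool := (2 <= (d %% 4)%Z)%R.

(** This is the condition of pit 4: going from (i, j) to (i - 1, j + 1) lowers i - j by 2. *)
Lemma raisedB2 (d : int) : raised (d - 2) = ~~ raised d.
Proof. by rewrite /raised; lia. Qed.

Definition height (R : realType) (w : R) (e : bool) (k : int) : R :=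
  period w * (k%:~R + (if e then 1 / 2 else 0)).

Lemma int_between (R : realType) (m : int) (a b : int) :
  (a%:~R : R) < (m%:~R : R) < (b%:~R : R) -> a < m < b.
Proof. by rewrite !ltr_int. Qed.

Lemma int_in_unit_gap (l m : int) : l < m < l + 2 -> m = l + 1.
Proof. by lia. Qed.

(** The two heights differ by less than a period. Their difference is a multiple of the period when
    [e = e'], and an odd multiple of half a period otherwise. *)
Lemma height_unique (R : realType) (w z : R) (e e' : bool) (k k' : int) : 0 < w ->
  0 <= z - height w e k < period w -> 0 <= z - height w e' k' < period w ->
  if e == e' then k = k'
  else z - height w e' k' = z - height w e k + period w / 2 \/
       z - height w e' k' = z - height w e k - period w / 2.
Proof.
move=> w0; rewrite /height.
have P0 : 0 < period w by rewrite /period; lra.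
set c := (if e then _ else _); set c' := (if e' then _ else _).
move=> h h'; pose D : R := (k' - k)%:~R + (c' - c).
have : period w * (- 1) < period w * D < period w * 1.
  by rewrite /D intrB; lra.
rewrite !(ltr_pM2l P0) => /andP[D1 D2].
have zE : z - period w * (k'%:~R + c') = z - period w * (k%:~R + c) - period w * D.
  by rewrite /D intrB; ring.
rewrite zE; move: D1 D2 {h h' zE}; rewrite /D /c /c' {D c c'}; case: e; case: e' => /= D1 D2.
- have /int_between : ((-1)%:~R : R) < ((k' - k)%:~R : R) < (1%:~R : R) by lra.
  by lia.
- have /int_between : ((-1)%:~R : R) < ((k' - k)%:~R : R) < (2%:~R : R) by lra.
  have [-> _|nk /andP[k1 k2]] := eqVneq (k' - k) 0; first by left; lra.
  by rewrite (_ : k' - k = 1); [right; lra|lia].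
- have /int_between : ((-2)%:~R : R) < ((k' - k)%:~R : R) < (1%:~R : R) by lra.
  have [-> _|nk /andP[k1 k2]] := eqVneq (k' - k) 0; first by right; lra.
  by rewrite (_ : k' - k = -1); [left; lra|lia].
- have /int_between : ((-1)%:~R : R) < ((k' - k)%:~R : R) < (1%:~R : R) by lra.
  by lia.
Qed.

Lemma height_exists (R : realType) (w z : R) (e : bool) : 0 < w ->
  exists k, 0 <= z - height w e k < period w.
Proof.
move=> w0; have P0 : 0 < period w by rewrite /period; lra.
pose c : R := if e then 1 / 2 else 0.
exists (Num.floor (z / period w - c)); rewrite /height -/c.
have := floor_itv (z / period w - c); set k := Num.floor _.
have zP : z = period w * (z / period w) by rewrite mulrC divfK// gt_eqF.
rewrite intrD => /andP[k1 k2].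
have : 0 <= (z / period w - (k%:~R + c)) < 1 by lra.
have -> : z - period w * (k%:~R + c) = period w * (z / period w - (k%:~R + c)).
  by rewrite mulrBr -zP.
move=> /andP[u0 u1].
by apply/andP; split; [exact: mulr_ge0 (ltW P0) u0|rewrite gtr_pMr].
Qed.

(** An unraised column also describes the subdivision of the other axes. *)
Lemma cell_exists (R : realType) (w x : R) : 0 < w ->
  exists k : int, 0 <= x - period w * k%:~R < period w.
Proof.
move=> w0; have [k] := height_exists x false w0.
by rewrite /height addr0; exists k.
Qed.

(* Every pin is a translated pit; the alternative records which cell the pit belongs to. *)
Lemma in_tile_pit (R : realType) (w x y z : R) (a b : int) (o q : bool) :
  0 < w -> w <= 1 / 40 -> 0 <= x < period w -> 0 <= y < period w ->
  in_tile w (x - period w * a%:~R) (y - period w * b%:~R) z o q ->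
  [\/ [/\ a = 0, b = 0 & main_part w x y z o q],
      [/\ a = 1, b = 0, q & pit1 w x y z || pit2 w x y z],
      [/\ a = 1, b = 1, q & pit3 w x y z] |
      [/\ a = -1, b = 1, q & pit4 w x y (z + period w / 2)]].
Proof.
move=> w0 w1 xP yP.
have P0 : 1 < period w by rewrite /period; lra.
have PP : 0 < period w by lra.
have between (m l : int) :
    period w * l%:~R < period w * m%:~R < period w * (l + 2)%:~R -> m = l + 1.
  by rewrite !(ltr_pM2l PP) !ltr_int => /int_in_unit_gap.
have w2 : 2 * w < period w by rewrite /period; lra.
have at0 m u : 0 <= u < period w -> 0 <= u - period w * m%:~R < period w -> m = 0.
  by move=> uP umP; apply: (between m (-1)); lra.
have at1 m u : 0 <= u < period w -> 0 <= u - period w * m%:~R + period w < period w ->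
    m = 1.
  by move=> uP umP; apply: (between m 0); lra.
have atN1 m u : 0 <= u < period w -> 0 <= u - period w * m%:~R - period w < period w ->
    m = -1.
  by move=> uP umP; apply: (between m (-2)); lra.
case/orP => [m|/andP[q1 /or4P[] m]].
- have /and5P[_ x1 y1 _ _] := m.
  have a0 := at0 _ _ xP x1; have b0 := at0 _ _ yP y1.
  by constructor 1; split => //; move: m; rewrite a0 b0 !mulr0 !subr0.
- have /and3P[x1 y1 _] := m.
  have a1 : a = 1 by apply: (at1 _ _ xP); lra.
  have b0 : b = 0 by apply: (at0 _ _ yP); rewrite /period in y1 *; lra.
  constructor 2; split => //; move: m.
  by rewrite a1 b0 mulr0 mulr1 subr0 /pin1 subrK => ->.
- have /and3P[x1 y1 _] := m.
  have a1 : a = 1 by apply: (at1 _ _ xP); lra.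
  have b0 : b = 0 by apply: (at0 _ _ yP); rewrite /period in y1 *; lra.
  constructor 2; split => //; move: m.
  by rewrite a1 b0 mulr0 mulr1 subr0 /pin2 subrK => ->; rewrite orbT.
- have /and3P[x1 y1 _] := m.
  have a1 : a = 1 by apply: (at1 _ _ xP); lra.
  have b1 : b = 1 by apply: (at1 _ _ yP); lra.
  constructor 3; split => //; move: m.
  by rewrite a1 b1 mulr1 /pin3 !subrK.
- have /and3P[x1 y1 _] := m.
  have a1 : a = -1 by apply: (atN1 _ _ xP); lra.
  have b1 : b = 1 by apply: (at1 _ _ yP); lra.
  constructor 4; split => //; move: m.
  by rewrite a1 b1 mulrN1 opprK mulr1 /pin4 addrK subrK.
Qed.

(** * The translation set and the partition it defines *)

Definition node (R : realType) (n : nat) (w : R) (m : 'rV[int]_n.+3) : 'rV[R]_n.+3 :=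
  \row_i (if i == ix2 n then
            height w (raised (m 0 (ix0 n) - m 0 (ix1 n))) (m 0 (ix2 n))
          else period w * (m 0 i)%:~R).

Definition nodes (R : realType) (n : nat) (w : R) : set 'rV[R]_n.+3 :=
  [set t | exists m, t = node w m].

Lemma node2E (R : realType) (n : nat) (w : R) (m : 'rV[int]_n.+3) :
  node w m 0 (ix2 n) = height w (raised (m 0 (ix0 n) - m 0 (ix1 n))) (m 0 (ix2 n)).
Proof. by rewrite mxE eqxx. Qed.

Lemma nodeE (R : realType) (n : nat) (w : R) (m : 'rV[int]_n.+3) (i : 'I_n.+3) :
  i != ix2 n -> node w m 0 i = period w * (m 0 i)%:~R.
Proof. by rewrite mxE => /negbTE ->. Qed.

Lemma cell_unique (R : realType) (w u : R) (k k' : int) : 0 < w ->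
  0 <= u - period w * k%:~R < period w -> 0 <= u - period w * k'%:~R < period w ->
  k = k'.
Proof.
move=> w0 h h'; have := @height_unique R w u false false k k' w0.
by rewrite /height !addr0; apply.
Qed.

(** A shift by half a period exchanges the pits 1 and 2, so they allow neighbouring columns with
    equal or with different shifts. *)
Lemma pit12_half_period (R : realType) (w x y z z' : R) : 0 < w -> w <= 1 / 40 ->
  0 <= z' < period w -> z = z' + period w / 2 \/ z = z' - period w / 2 ->
  pit1 w x y z || pit2 w x y z -> pit1 w x y z' || pit2 w x y z'.
Proof.
move=> w0 w1 z'P zz' /orP[]; rewrite /pit1 /pit2 /pit12; cbv zeta =>
  /and3P[-> -> zP]; rewrite /=; move: z'P zP; rewrite /period;
  case: zz' => ->; rewrite /period; lra.
Qed.

(** The first alternative would make [z'] negative; in the second one z + P / 2 is [z']. *)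
Lemma pit4_half_period (R : realType) (w x y z z' : R) : 0 < w -> w <= 1 / 40 ->
  0 <= z' < period w -> z = z' + period w / 2 \/ z = z' - period w / 2 ->
  pit4 w x y (z + period w / 2) -> pit4 w x y z'.
Proof.
move=> w0 w1 z'P zz'; rewrite /pit4; cbv zeta => /and3P[-> -> zP] /=.
move: z'P zP; rewrite /period; case: zz' => ->; rewrite /period; lra.
Qed.

(* [(I, J)] is the cell containing a point and [(x, y, z)] the position of the point in it;
   the copy of the tile covering the point stands in the cell [(a, b)]. *)
Definition own_part (R : realType) (w x y z : R) (I J a b : int) (o q : bool) : bool :=
  [|| [&& a == I, b == J & main_part w x y z o q],
      [&& a == I + 1, b == J, q & pit1 w x y z || pit2 w x y z],
      [&& a == I + 1, b == J + 1, q & pit3 w x y z] |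
      [&& a == I - 1, b == J + 1, q & pit4 w x y z]].

(** The main part, the pits 1 and 2 together, the pit 3 and the pit 4 are disjoint, and each of
    these regions prescribes the covering column. *)
Lemma own_part_unique (R : realType) (w x y z : R) (I J a b a' b' : int) (o q : bool) :
  0 < w -> w <= 1 / 40 ->
  own_part w x y z I J a b o q -> own_part w x y z I J a' b' o q -> a = a' /\ b = b'.
Proof.
move=> w0 w1.
have P1 : 0 < period w by rewrite /period; lra.
have dis1 : pit1 w x y z || pit2 w x y z -> pit3 w x y z || pit4 w x y z -> False.
  by case/orP => /and3P[x1 y1 z1]; case/orP => /and3P[x2 y2 z2];
    move: x1 y1 z1 x2 y2 z2; rewrite /period; cbv zeta; lra.
have dis2 : pit3 w x y z -> pit4 w x y z -> False.
  by move=> /and3P[x1 y1 z1] /and3P[x2 y2 z2];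
    move: x1 y1 z1 x2 y2 z2; rewrite /period; cbv zeta; lra.
have dis0 : main_part w x y z o q ->
    [&& q & [|| pit1 w x y z || pit2 w x y z, pit3 w x y z | pit4 w x y z]] -> False.
  by case/and5P => _ _ _ _ /negP nq /andP[q1 pit]; apply: nq; rewrite q1 /= orbA.
case/or4P => [/and3P[/eqP-> /eqP-> m]|/and4P[/eqP-> /eqP-> q1 m]
             |/and4P[/eqP-> /eqP-> q1 m]|/and4P[/eqP-> /eqP-> q1 m]];
case/or4P => [/and3P[/eqP-> /eqP-> m']|/and4P[/eqP-> /eqP-> q2 m']
             |/and4P[/eqP-> /eqP-> q2 m']|/and4P[/eqP-> /eqP-> q2 m']] //;
exfalso.
- by apply: (dis0 m); rewrite q2 m'.
- by apply: (dis0 m); rewrite q2 m' orbT.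
- by apply: (dis0 m); rewrite q2 m' !orbT.
- by apply: (dis0 m'); rewrite q1 m.
- by apply: (dis1 m); rewrite m'.
- by apply: (dis1 m); rewrite m' orbT.
- by apply: (dis0 m'); rewrite q1 m orbT.
- by apply: (dis1 m'); rewrite m.
- exact: dis2 m m'.
- by apply: (dis0 m'); rewrite q1 m !orbT.
- by apply: (dis1 m'); rewrite m orbT.
- exact: dis2 m' m.
Qed.

Lemma diag_diff (I J : int) : I + 1 - (J + 1) = I - J.
Proof. by lia. Qed.

Lemma antidiag_diff (I J : int) : I - 1 - (J + 1) = I - J - 2.
Proof. by lia. Qed.

(** The pin is located by heights in the column (a, b), the pit by heights in the column (I, J). The
    rule for [raised] makes the two agree: equal shifts for pit 3, opposite ones for pit 4, any for
    the pits 1 and 2. *)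
Lemma in_tile_own_part (R : realType) (w x y z : R) (I J k a b c : int) (o q : bool) :
  0 < w -> w <= 1 / 40 ->
  0 <= x - period w * I%:~R < period w -> 0 <= y - period w * J%:~R < period w ->
  0 <= z - height w (raised (I - J)) k < period w ->
  in_tile w (x - period w * a%:~R) (y - period w * b%:~R)
    (z - height w (raised (a - b)) c) o q ->
  own_part w (x - period w * I%:~R) (y - period w * J%:~R)
    (z - height w (raised (I - J)) k) I J a b o q.
Proof.
move=> w0 w1 xI yJ zk ht.
have [_ _ zc _] := in_tile_range w0 w1 ht.
have hu := height_unique w0 zk zc.
have aE : a = I + (a - I) by rewrite addrC subrK.
have bE : b = J + (b - J) by rewrite addrC subrK.
have shift u (i j : int) : u - period w * i%:~R =
    u - period w * j%:~R - period w * (i - j)%:~R by rewrite intrB; ring.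
rewrite (shift x a I) (shift y b J) in ht.
rewrite /own_part; have := in_tile_pit w0 w1 xI yJ ht; rewrite {ht}.
case=> -[a0 b0 +]; rewrite a0 in aE; rewrite b0 in bE; rewrite aE bE in hu *; rewrite ?addr0.
- by rewrite !addr0 eqxx in hu *; rewrite !eqxx -hu => ->.
- move=> q1 m; apply/orP; right; apply/orP; left.
  rewrite addr0 in hu; rewrite !eqxx q1 /=; move: hu; case: eqP => [e|_] zz.
    by rewrite e zz.
  exact: (pit12_half_period w0 w1 zk zz).
- move=> q1 m; apply/orP; right; apply/orP; right; apply/orP; left.
  rewrite !eqxx q1 /=; move: hu m.
  by rewrite diag_diff eqxx => ->.
- move=> q1 m; apply/orP; right; apply/orP; right; apply/orP; right.
  rewrite !eqxx q1 /=; move: hu m.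
  rewrite antidiag_diff raisedB2; case: eqP => [/eqP|_ zz m].
    by case: (raised _).
  exact: (pit4_half_period w0 w1 zk zz m).
Qed.

Lemma nodes_cover (R : realType) (w x y z : R) (q : bool) : 0 < w -> w <= 1 / 40 ->
  exists a b c : int, in_tile w (x - period w * a%:~R) (y - period w * b%:~R)
    (z - height w (raised (a - b)) c) true q.
Proof.
move=> w0 w1.
have [I xI] := cell_exists x w0; have [J yJ] := cell_exists y w0.
have [k zk] := height_exists z (raised (I - J)) w0.
have [m|nm] := boolP (main_part w (x - period w * I%:~R) (y - period w * J%:~R)
    (z - height w (raised (I - J)) k) true q).
  by exists I, J, k; rewrite /in_tile m.
have /andP[q1 pit] : q && [|| pit1 w (x - period w * I%:~R) (y - period w * J%:~R)
      (z - height w (raised (I - J)) k),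
    pit2 w (x - period w * I%:~R) (y - period w * J%:~R)
      (z - height w (raised (I - J)) k),
    pit3 w (x - period w * I%:~R) (y - period w * J%:~R)
      (z - height w (raised (I - J)) k) |
    pit4 w (x - period w * I%:~R) (y - period w * J%:~R)
      (z - height w (raised (I - J)) k)].
  by apply/negPn; apply: contra nm => npit; apply/and5P.
rewrite q1 {nm q1}.
have p1 u (i : int) : u - period w * (i + 1)%:~R + period w = u - period w * i%:~R.
  by rewrite intrD; ring.
have m1 u (i : int) : u - period w * (i - 1)%:~R - period w = u - period w * i%:~R.
  by rewrite intrB; ring.
have pit12 : pit1 w (x - period w * I%:~R) (y - period w * J%:~R)
      (z - height w (raised (I - J)) k) ||
    pit2 w (x - period w * I%:~R) (y - period w * J%:~R)
      (z - height w (raised (I - J)) k) ->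
    exists a b c : int, in_tile w (x - period w * a%:~R) (y - period w * b%:~R)
      (z - height w (raised (a - b)) c) true true.
  (* In the heights of the neighbouring column the point may be in the other one of the pits 1 and
     2; it is then covered by the other pin. *)
  move=> pit12; have [c zc] := height_exists z (raised (I + 1 - J)) w0.
  exists (I + 1), J, c.
  suff : pit1 w (x - period w * I%:~R) (y - period w * J%:~R)
      (z - height w (raised (I + 1 - J)) c) ||
    pit2 w (x - period w * I%:~R) (y - period w * J%:~R)
      (z - height w (raised (I + 1 - J)) c).
    by case/orP => m; [apply: in_tile_pin1|apply: in_tile_pin2];
      rewrite /pin1 /pin2 p1.
  have := height_unique w0 zc zk; case: eqP => [-> ->//|_ zz].
  exact: (pit12_half_period w0 w1 zc zz).
case/or4P: pit => m; [by apply: pit12; rewrite m|by apply: pit12; rewrite m orbT|..].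
- exists (I + 1), (J + 1), k; apply: in_tile_pin3.
  by rewrite /pin3 !p1 diag_diff.
- have [c zc] := height_exists z (raised (I - 1 - (J + 1))) w0.
  exists (I - 1), (J + 1), c; apply: in_tile_pin4; rewrite /pin4 p1 m1.
  have := height_unique w0 zk zc.
  (* The shifts are opposite, and the point has height at least 3P / 4 in its own column, so its
     height in the other column is half a period less. *)
  rewrite antidiag_diff raisedB2 in zc *; rewrite ifF; last by case: (raised _).
  have /and3P[_ _ z4] := m; case=> zz; last by rewrite zz subrK.
  by exfalso; rewrite zz in zc; move: zc z4; rewrite /period; lra.
Qed.

Lemma sub_nodeE (R : realType) (n : nat) (w : R) (x : 'rV[R]_n.+3) (m : 'rV[int]_n.+3)
    (i : 'I_n.+3) : i != ix2 n -> (x - node w m) 0 i = x 0 i - period w * (m 0 i)%:~R.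
Proof. by move=> i2; rewrite row_addE row_oppE nodeE. Qed.

Lemma sub_node2E (R : realType) (n : nat) (w : R) (x : 'rV[R]_n.+3) (m : 'rV[int]_n.+3) :
  (x - node w m) 0 (ix2 n) =
  x 0 (ix2 n) - height w (raised (m 0 (ix0 n) - m 0 (ix1 n))) (m 0 (ix2 n)).
Proof. by rewrite row_addE row_oppE node2E. Qed.

Lemma other_neq2 (n : nat) (i : 'I_n.+3) : (2 < i)%N -> i != ix2 n.
Proof. by move=> i2; rewrite -val_eqE /= gtn_eqF. Qed.

Lemma nodes_disjoint (R : realType) (n : nat) (w : R) (x : 'rV[R]_n.+3)
    (m m' : 'rV[int]_n.+3) : 0 < w -> w <= 1 / 40 ->
  tile w (x - node w m) -> tile w (x - node w m') -> m = m'.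
Proof.
move=> w0 w1 Em Em'.
have [_ _ z /others_inP om] := tile_range w0 w1 Em.
have [_ _ z' /others_inP om'] := tile_range w0 w1 Em'.
have mo (i : 'I_n.+3) : (2 < i)%N -> m 0 i = m' 0 i.
  move=> i2; have := om i i2; have := om' i i2.
  rewrite !sub_nodeE ?other_neq2// => h' h; exact: cell_unique w0 h h'.
(* Both copies see the same remaining coordinates, so the comparison reduces to the first three with
   common [o] and [q]. *)
have oE lo hi : others_in lo hi (x - node w m') = others_in lo hi (x - node w m).
  apply: eq_forallb => i; case: (ltnP 2 i) => //= i2.
  by rewrite !sub_nodeE ?other_neq2// mo.
have [I xI] := cell_exists (x 0 (ix0 n)) w0.
have [J yJ] := cell_exists (x 0 (ix1 n)) w0.
have [k zk] := height_exists (x 0 (ix2 n)) (raised (I - J)) w0.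
move: Em Em' z z'; rewrite /tile /= !oE !sub_node2E !sub_nodeE// => Em Em' z z'.
have [m0 m1] := own_part_unique w0 w1 (in_tile_own_part w0 w1 xI yJ zk Em)
  (in_tile_own_part w0 w1 xI yJ zk Em').
apply/rowP => i; case: (ixP i) => [|||j]; [exact: m0|exact: m1| |exact: mo].
have := height_unique w0 z z'.
by rewrite m0 m1 eqxx.
Qed.

Lemma nodes_cover_row (R : realType) (n : nat) (w : R) (x : 'rV[R]_n.+3) :
  0 < w -> w <= 1 / 40 -> exists m, tile w (x - node w m).
Proof.
move=> w0 w1.
have [f fP] := choice (fun i : 'I_n.+3 => cell_exists (x 0 i) w0).
(* The cells of the remaining coordinates decide whether pits and pins are present, before the first
   three indices are chosen. *)
pose q := [forall i : 'I_n.+3, (2 < i)%N ==>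
  (period w / 4 <= x 0 i - period w * (f i)%:~R < period w / 4 + w)].
have [a [b [c abc]]] := nodes_cover (x 0 (ix0 n)) (x 0 (ix1 n)) (x 0 (ix2 n)) q w0 w1.
pose m : 'rV[int]_n.+3 := \row_i
  (match val i with 0%N => a | 1%N => b | 2%N => c | _ => f i end).
have mo (i : 'I_n.+3) : (2 < i)%N -> m 0 i = f i.
  by rewrite mxE; case: i => -[|[|[]]].
have m0 : m 0 (ix0 n) = a by rewrite mxE.
have m1 : m 0 (ix1 n) = b by rewrite mxE.
have m2 : m 0 (ix2 n) = c by rewrite mxE.
exists m; rewrite /tile /= sub_node2E !sub_nodeE// m0 m1 m2.
have -> : others_in 0 (period w) (x - node w m).
  by apply/others_inP => i i2; rewrite sub_nodeE ?other_neq2// mo.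
rewrite (_ : others_in _ _ _ = q)//.
apply: eq_forallb => i; case: (ltnP 2 i) => //= i2.
by rewrite sub_nodeE ?other_neq2// mo.
Qed.

Lemma finite_bounded_int_rows (n : nat) (N : nat) :
  finite_set [set m : 'rV[int]_n | forall i, (`|m 0%R i| <= N)%N].
Proof.
pose g (f : {ffun 'I_n -> 'I_(N + N).+1}) : 'rV[int]_n :=
  \row_i ((f i)%:Z - N%:Z).
apply: (@sub_finite_set _ _ (g @` setT)); last exact/finite_image/finite_finset.
move=> m mN.
have lt_i i : (`|(m 0 i + N%:Z)%R| < (N + N).+1)%N by have := mN i; lia.
exists [ffun i => Ordinal (lt_i i)] => //.
apply/rowP => i; rewrite mxE ffunE /=; have := mN i; lia.
Qed.

Lemma nodes_discrete (R : realType) (n : nat) (w : R) : 0 < w ->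
  discrete_set (@nodes R n w).
Proof.
move=> w0 r.
pose N := (Num.truncn (r + 2)).+1.
apply: (@sub_finite_set _ _ (@node R n w @` [set m : 'rV[int]_n.+3 | forall i, (`|m 0%R i| <= N)%N]));
  last exact/finite_image/finite_bounded_int_rows.
move=> _ [[m ->] bm]; exists m => // i.
have rN : r + 2 < N%:R by exact: truncnS_gt.
have P1 : 1 <= period w by rewrite /period; lra.
(* Here [c] is the possible shift of the column. As the period is at least 1, the integer coordinate
   is at most r + 1 / 2 in absolute value, hence below [N]. *)
have [c c01 mc] : exists2 c : R, 0 <= c <= 1 / 2 &
    `|period w * ((m 0 i)%:~R + c)| <= r.
  have := bm i; have [->|i2] := eqVneq i (ix2 n); last first.
    by rewrite nodeE//; exists 0; [lra|rewrite addr0].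
  rewrite node2E /height; set c := (if _ then _ else _) => mc; exists c => //.
  by rewrite /c; case: ifP; lra.
have : `|(m 0 i)%:~R + c| <= r.
  apply: le_trans mc; rewrite normrM ger0_norm ?(le_trans _ P1)//.
  exact: ler_peMl.
rewrite ler_norml => mcr.
have : (- (N%:Z))%:~R < ((m 0 i)%:~R : R) < (N%:Z)%:~R by rewrite intrN; lra.
by rewrite !ltr_int; lia.
Qed.

Lemma tile_tiling (R : realType) (n : nat) (w : R) : 0 < w -> w <= 1 / 40 ->
  tiling_of (@tile R n w) (@nodes R n w).
Proof.
move=> w0 w1.
split; [|exact: nodes_discrete|move=> t t' [m ->] [m' ->] mm'|].
- split; first exact: tile_measurable.
  split.
    apply: (@right_clopen_outer_gt0 _ _ _ 0); first exact: right_clopen_tile.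
    by apply: cube_sub_tile => // i; rewrite mxE lexx ler01.
  apply: (@le_lt_trans _ _ (box_vol (const_mx (- 2)) (const_mx 2) : R)%:E); last exact: ltry.
  apply: lebesgue_outer_sub_box => x /(tile_bounded w0 w1) xb i.
  by have := xb i; rewrite !mxE; lra.
- rewrite (_ : _ `&` _ = set0) ?lebesgue_outer0//.
  apply/seteqP; split => // x [/translateE Em /translateE Em'].
  by move: mm'; rewrite (nodes_disjoint w0 w1 Em Em') eqxx.
- rewrite (_ : ~` _ = set0) ?lebesgue_outer0//.
  apply/seteqP; split => // x; apply.
  have [m Em] := nodes_cover_row x w0 w1.
  by exists (node w m); [exists m | apply/translateE].
Qed.

Theorem theorem1p4 (R : realType) (n : nat) (hn : (3 <= n)%N)
  (eps : R) (heps : 0 < eps) :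
  exists E : set 'rV[R]_n,
    [/\ lebesgue_measurable E,
        [set x : 'rV[R]_n | forall i, 0 <= x 0 i <= 1] `<=` E,
        E `<=` [set x : 'rV[R]_n | forall i, - eps <= x 0 i <= 1 + eps],
        tiles E &
        ~ tiles_by_lattice E].
Proof.
case: n hn => [|[|[|n]]]// _.
(* The tile exceeds the unit cube by at most 5w; 1 / 40 keeps the pits small against the period. *)
pose w := Num.min (eps / 5) (1 / 40).
have w0 : 0 < w by rewrite lt_min; lra.
have weps : w <= eps / 5 by rewrite ge_min lexx.
have w1 : w <= 1 / 40 by rewrite ge_min lexx orbT.
exists (tile w); split.
- exact: tile_measurable.
- exact: cube_sub_tile.
- by move=> x /(tile_bounded w0 w1) xb i; have := xb i; lra.
- by exists (@nodes R n w); exact: tile_tiling.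
- by move=> [A [_]]; exact: tile_not_lattice.
Qed.
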